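(* Fix $\varepsilon\in(0,1)$. There is a randomized algorithm which, given $n$, an explicitly known forest $H$ on $n$ vertices, and oracle access in the adjacency list model to an unknown forest $G$ on $n$ vertices, accepts with probability at least $2/3$ if $G$ is isomorphic to $H$, and rejects with probability at least $2/3$ if $d(G,H)\ge \varepsilon n$. The number of queries it makes to the oracle is $\mathrm{polylog}(n)$ (the polylogarithmic bound may depend on $\varepsilon$).
   Context: Adjacency list model: the vertex set $V$ of $G$ (with $|V|=n$) is known. The oracle answers degree queries (given $v$, return $\deg_G(v)$) and neighbor queries (given $v$ and $i$, return the $i$-th neighbor of $v$ in a fixed but arbitrary ordering of its adjacency list). For graphs $G,H$ on the same number of vertices, $d(G,H)$ is the minimum over bijections $\pi:V(G)\to V(H)$ of the number of pairs $\{u,v\}$ that are edges in exactly one of $G$ and of $H$ after identifying via $\pi$; i.e., the minimum number of edge additions and removals needed to make $G$ isomorphic to $H$. *)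

(* Defs.v *)
From HB Require Import structures.
From mathcomp Require Import all_boot all_order all_algebra all_fingroup.
From mathcomp Require Import reals exp.

Set Implicit Arguments.
Unset Strict Implicit.
Unset Printing Implicit Defensive.

Import Order.TTheory GRing.Theory Num.Theory.
Local Open Scope ring_scope.

Record sgraph (T : finType) := SGraph {
  edge :> rel T;
  edge_sym : symmetric edge;
  edge_irrefl : irreflexive edge }.

Definition degree (T : finType) (G : sgraph T) (v : T) : nat :=
  #|[set u | G v u]|.

(* [ucycle] alone also accepts [::] and the 2-cycles [:: u; v] of a single
   edge, hence the bound on the length. *)
Definition is_forest (T : finType) (G : sgraph T) : Prop :=
  forall c : seq T, (2 < size c)%N -> ~ ucycle G c.

Definition isomorphic (T : finType) (G H : sgraph T) : Prop :=
  exists p : {perm T}, forall u v, G u v = H (p u) (p v).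

(* Unordered pairs {u, v} that are an edge of exactly one of G and H once
   V(G) is identified with V(H) via p. *)
Definition disagreement (T : finType) (G H : sgraph T) (p : {perm T}) :
    {set {set T}} :=
  [set [set uv.1; uv.2] | uv : T * T & G uv.1 uv.2 (+) H (p uv.1) (p uv.2)].

Definition graph_dist (T : finType) (G H : sgraph T) : nat :=
  #|disagreement G H
      [arg min_(p < (1%g : {perm T})) #|disagreement G H p| ]|.

Record adj_lists (T : finType) (G : sgraph T) := AdjLists {
  adj :> T -> seq T;
  adj_uniq : forall v, uniq (adj v);
  mem_adj : forall v u, (u \in adj v) = G v u }.

(* Adaptive randomized query algorithms on the vertex set T: each query node
   continues according to the oracle's answer, and [Draw m] draws an element of
   'I_m.+1 uniformly, independently of all other draws.  The output [true]
   means "accept".  Only the number of queries is a resource, so no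
   computability is imposed on the continuations. *)
Inductive algorithm (T : Type) : Type :=
| Output of bool
| AskDegree of T & (nat -> algorithm T)
| AskNeighbor of T & nat & (option T -> algorithm T)
| Draw (m : nat) of ('I_m.+1 -> algorithm T).

Section Run.
Variables (R : realType) (T : finType) (G : sgraph T) (L : adj_lists G).

(* Neighbors are numbered from 0; the answer is [None] when i >= deg v. *)
Fixpoint output_prob (A : algorithm T) (b : bool) : R :=
  match A with
  | Output b' => (b' == b)%:R
  | AskDegree v k => output_prob (k (degree G v)) b
  | AskNeighbor v i k => output_prob (k (onth (L v) i)) b
  | Draw m k => (\sum_(j < m.+1) output_prob (k j) b) / m.+1%:R
  end.

(* Number of oracle queries, in the worst case over the random draws. *)
Fixpoint num_queries (A : algorithm T) : nat :=
  match A with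
  | Output _ => 0%N
  | AskDegree v k => (num_queries (k (degree G v))).+1
  | AskNeighbor v i k => (num_queries (k (onth (L v) i))).+1
  | Draw m k => (\max_(j < m.+1) num_queries (k j))%N
  end.

End Run.

(* The range n >= 2 avoids ln 1 = 0. *)
Definition polylog (R : realType) (q : nat -> nat) : Prop :=
  exists (C : R) (c : nat),
    forall n : nat, (1 < n)%N -> (q n)%:R <= C * ln n%:R ^+ c.

(* Main.v *)
Require Import Defs.
From HB Require Import structures.
From mathcomp Require Import all_boot all_order all_algebra all_fingroup.
From mathcomp Require Import reals exp.
From mathcomp Require Import boolp ring lra zify.

Set Implicit Arguments.
Unset Strict Implicit.
Unset Printing Implicit Defensive.

Import Order.TTheory GRing.Theory Num.Theory.
Local Open Scope ring_scope.

(** All the randomness is drawn before the first query, as a seed consisting of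
    random marks on the vertices, random indices into the adjacency lists, and a
    random sample of vertices.  The queries then compute a transcript that is a
    deterministic function of the seed and of the oracle, and the tester accepts
    when some forest isomorphic to H has the observed transcript and is typical
    for the seed.  It therefore suffices that every forest is typical with
    probability at least 2/3, and that two forests that are typical for the same
    seed and share a transcript are close; no isomorphism invariance of the
    transcript is needed.

    Deleting the edges at the marked vertices and between the vertices of degree
    at least D cuts the rest of the forest into cells.  Few vertices are deep
    below the top of their cell, so few lie in a large cell; and since every
    vertex has at most one parent, few edges join a cell to a second vertex of
    high degree.  Up to few edges, the forest is thus a union of boundedly many
    kinds of small trees, some of them hanging from high-degree vertices.  A
    high-degree vertex is classified by its degree, rounded to constant relative
    precision, and by the kinds of a constant number of sampled neighbours.
    There are O(log n) classes, so polylogarithmically many sampled vertices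
    estimate the weight of each class, and two forests with nearly equal weights
    are matched class by class, then small tree by small tree. *)

(** * Rooted forests *)

(** Roots are the fixed points of [par], and [rk] excludes cycles of parents. Every edge belongs to
    exactly one endpoint, its child, so edges can be counted as vertices [v] with [par v != v]. *)
Definition rooting (T : finType) (G : sgraph T) (par : T -> T)
    (rk : T -> nat) : Prop :=
  (forall u, par u != u -> (rk (par u) < rk u)%N) /\
  (forall u v, G u v = (u != v) && ((par u == v) || (par v == u))).

(** If every vertex of [S] had two neighbours in [S], a path in [S] could be prolonged at its head
    [x] forever: a neighbour of [x] other than the next vertex is either new or closes a cycle. *)
Lemma forest_leaf (T : finType) (G : sgraph T) (S : {set T}) :
  is_forest G -> S != set0 ->
  exists2 v, v \in S & (#|[set u in S | G v u]| <= 1)%N.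
Proof.
move=> forG /set0Pn[z zS].
apply/exists_inP; apply: contraT => /exists_inPn minS; exfalso.
have ext (m : nat) : exists x p, [/\ size p = m, path G x p, uniq (x :: p) &
    {subset x :: p <= S}].
  elim: m => [|m [x [p [szp pathp uniqp subp]]]].
    by exists z, [::]; split=> // y; rewrite inE => /eqP ->.
  have xS : x \in S by apply: subp; rewrite mem_head.
  have := minS x xS; rewrite -ltnNge => gt1.
  (* For empty [p] the default [x] excludes nothing, since [x] is not its own neighbour. *)
  have [y /and3P[yS Gxy yh]] : exists y, [&& y \in S, G x y & y != head x p].
    have /card_gt0P[y] : (0 < #|[set u in S | G x u] :\ head x p|)%N.
      by move: gt1; rewrite (cardsD1 (head x p)); case: (_ \in _); lia.
    by rewrite !inE => /and3P[? ? ?]; exists y; apply/and3P.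
  have yx : y != x by apply: contraTneq Gxy => ->; rewrite edge_irrefl.
  have [yp|yNp] := boolP (y \in p); last first.
    exists y, (x :: p); split=> /=; first by rewrite szp.
    - by rewrite edge_sym Gxy.
    - by rewrite inE negb_or yx yNp.
    - by move=> w; rewrite inE => /orP[/eqP -> //|/subp].
  (* As [y] is not the head of [p], the segment [p1] is nonempty and the closed cycle has at least
     three vertices. *)
  case/splitPr: yp yh szp pathp uniqp subp => p1 p2.
  case: p1 => [|a p1] yh _ pathp uniqp _; first by rewrite /= eqxx in yh.
  have [q Eq] : exists q, q = a :: p1 by eexists.
  rewrite -Eq in pathp uniqp.
  case: (forG (x :: rcons q y)); first by rewrite Eq /= size_rcons.
  move: pathp uniqp; rewrite -cat_rcons cat_path -cat_cons cat_uniq.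
  move=> /andP[pathp _] /andP[uniqp _].
  apply/andP; split=> //=; rewrite rcons_path pathp last_rcons /=.
  by rewrite edge_sym.
have [x [p [szp _ uniqp _]]] := ext #|T|.
by have := max_card (mem (x :: p)); rewrite (card_uniqP uniqp) /= szp ltnn.
Qed.

(** Leaves are peeled off one at a time. The leaf removed from a set of [m.+1] vertices becomes a
    child of its only neighbour there, or a root if it has none, and gets rank [m], above all
    remaining vertices. *)
Lemma forest_rooting (T : finType) (G : sgraph T) :
  is_forest G -> exists (par : T -> T) (rk : T -> nat), rooting G par rk.
Proof.
move=> forG.
have main (m : nat) (S : {set T}) : #|S| = m ->
  exists (par : T -> T) (rk : T -> nat),
    [/\ forall u, u \in S -> (rk u < m)%N, forall u, u \in S -> par u \in S,
        forall u, u \in S -> par u != u -> (rk (par u) < rk u)%N &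
        {in S &, forall u v,
           G u v = (u != v) && ((par u == v) || (par v == u))}].
  elim: m S => [|m IHm] S cardS.
    have S0 : S = set0 by apply/eqP; rewrite -cards_eq0 cardS.
    by exists id, (fun=> 0%N); rewrite S0; split=> // u; rewrite ?in_set0.
  have /(forest_leaf forG)[v vS vleaf] : S != set0 by rewrite -cards_eq0 cardS.
  have [|par [rk [rklt parS pardec edgeS]]] := IHm (S :\ v).
    by move: cardS; rewrite (cardsD1 v) vS; lia.
  pose pv := odflt v [pick u | (u \in S) && G v u].
  exists (fun u => if u == v then pv else par u),
         (fun u => if u == v then m else rk u).
  have inSv u : u \in S -> u != v -> u \in S :\ v.
    by rewrite !inE => -> ->.
  have pvS : pv \in S by rewrite /pv; case: pickP => //= u /andP[].
  have pvE u : u \in S -> u != v -> G v u = (pv == u).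
    move=> uS uv; rewrite /pv; case: pickP => [w /andP[wS Gvw]|/(_ u)] /=.
      apply/idP/eqP => [Gvu|<- //].
      move: vleaf; rewrite (cardD1 u) (cardD1 w) !inE uS wS Gvu Gvw /=.
      by case: eqVneq => //=; lia.
    by rewrite uS /= => ->; rewrite eq_sym (negPf uv).
  have parv u : u \in S -> u != v -> (par u == v) = false.
    by move=> uS uv; have := parS u (inSv _ uS uv); rewrite !inE => /andP[/negPf].
  split.
  - move=> u uS; case: eqVneq => // uv.
    by have := rklt u (inSv _ uS uv); lia.
  - move=> u uS; case: eqVneq => // uv.
    by have := parS u (inSv _ uS uv); rewrite inE => /andP[].
  - move=> u uS; case: (eqVneq u v) => [-> pvv|uv paru].
      by rewrite (negPf pvv); apply: rklt; apply: inSv.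
    by rewrite parv //; apply: pardec => //; apply: inSv.
  - move=> u w uS wS; case: (eqVneq u v) => [->|uv]; case: (eqVneq w v) => [->|wv].
    + by rewrite edge_irrefl.
    + by rewrite parv // orbF pvE.
    + by rewrite parv // edge_sym pvE //= uv.
    + by rewrite edgeS //; apply: inSv.
have [par [rk [_ _ pardec edgeT]]] := main #|T| [set: T] (cardsT T).
exists par, rk; split=> [u|u v]; first by apply: pardec.
by apply: edgeT.
Qed.

(** Each vertex owns at most one edge, and each edge is seen from both ends. *)
Lemma sum_degree (T : finType) (G : sgraph T) (par : T -> T) (rk : T -> nat) :
  rooting G par rk -> (\sum_u degree G u <= 2 * #|T|)%N.
Proof.
case=> _ edgeE.
apply: (@leq_trans (\sum_u \sum_v ((par u == v) + (par v == u)))%N).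
  apply: leq_sum => u _; rewrite /degree -sum1dep_card big_mkcond.
  apply: leq_sum => v _; rewrite edgeE.
  by case: (u != v); case: (par u == v); case: (par v == u).
under eq_bigr do rewrite big_split /=.
rewrite big_split /= mul2n -addnn leq_add //.
  rewrite -sum1_card; apply: leq_sum => u _.
  by rewrite (bigD1 (par u)) //= eqxx big1 // => v; rewrite eq_sym => /negPf->.
rewrite exchange_big -sum1_card; apply: leq_sum => u _.
by rewrite (bigD1 (par u)) //= eqxx big1 // => v; rewrite eq_sym => /negPf->.
Qed.

(** * Matching by keys *)

(** The complements of [D] and of its image have the same size, so they are paired by position in
    their enumerations. *)
Lemma perm_extension (T : finType) (D : {set T}) (h : T -> T) :
  {in D &, injective h} -> exists p : {perm T}, {in D, p =1 h}.
Proof.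
move=> injh.
pose p x := if x \in D then h x
            else nth x (enum (~: (h @: D))) (index x (enum (~: D))).
have szE : #|~: (h @: D)| = #|~: D|.
  by have := cardsC D; have := cardsC (h @: D); rewrite card_in_imset //; lia.
have idx x : x \notin D -> (index x (enum (~: D)) < size (enum (~: (h @: D))))%N.
  by move=> xD; rewrite -cardE szE cardE index_mem mem_enum inE.
have pout x : x \notin D -> p x \notin h @: D.
  move=> xD; have := mem_nth x (idx x xD).
  by rewrite mem_enum inE /p (negPf xD).
have injp : injective p.
  move=> x y; case: (boolP (x \in D)) => xD; case: (boolP (y \in D)) => yD.
  - by rewrite /p xD yD; apply: injh.
  - by move=> E; have := pout y yD; rewrite -E /p xD imset_f.
  - by move=> E; have := pout x xD; rewrite E /p yD imset_f.
  - rewrite /p (negPf xD) (negPf yD) => /eqP.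
    rewrite (set_nth_default y x) ?idx // nth_uniq ?idx ?enum_uniq // => /eqP E.
    by rewrite -(nth_index x (s := enum (~: D)) (x := x)) ?mem_enum ?inE // E
               nth_index // mem_enum inE.
by exists (perm injp) => x xD; rewrite permE /p xD.
Qed.

Section Matching.
Variables (T K : finType) (A B : {set T}) (f g : T -> K).

Definition key_matched (s : {perm T}) (a : T) : bool :=
  [&& a \in A, s a \in B & g (s a) == f a].

Definition unmatched (s : {perm T}) : {set T} :=
  [set a in A | ~~ key_matched s a].

Definition fiber (C : {set T}) (h : T -> K) (k : K) : {set T} :=
  [set c in C | h c == k].

End Matching.

Lemma key_matchedV (T K : finType) (A B : {set T}) (f g : T -> K)
    (s : {perm T}) (a : T) :
  key_matched B A g f s^-1%g (s a) = key_matched A B f g s a.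
Proof. by rewrite /key_matched permK eq_sym andbCA. Qed.

Lemma card_index_ge (T : finType) (C : {set T}) (m : nat) :
  (#|[set a in C | (m <= index a (enum C))%N]| <= #|C| - m)%N.
Proof.
rewrite cardE [#|C|]cardE -size_drop -(size_map id).
apply: uniq_leq_size; first by rewrite map_id enum_uniq.
move=> a; rewrite map_id mem_enum inE => /andP[aC le].
have aeC : a \in enum C by rewrite mem_enum.
rewrite -(nth_index a aeC) -{1}(subnKC le) -nth_drop mem_nth // size_drop.
by rewrite ltn_sub2r // ?index_mem // (leq_ltn_trans le) ?index_mem.
Qed.

(** Within each key the i-th element of the fibre in [A] goes to the i-th element of the fibre in
    [B]. Only the surplus of the larger fibre is left over, and one permutation serves both
    directions. *)
Lemma matching_exists (T K : finType) (A B : {set T}) (f g : T -> K) :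
  exists s : {perm T},
    (forall k, (#|fiber (unmatched A B f g s) f k|
                  <= #|fiber A f k| - #|fiber B g k|)%N) /\
    (forall k, (#|fiber (unmatched B A g f s^-1%g) g k|
                  <= #|fiber B g k| - #|fiber A f k|)%N).
Proof.
pose Af k := enum (fiber A f k); pose Bg k := enum (fiber B g k).
pose D := [set a in A | (index a (Af (f a)) < #|fiber B g (f a)|)%N].
pose h a := nth a (Bg (f a)) (index a (Af (f a))).
have hin a : a \in D -> h a \in fiber B g (f a).
  by rewrite inE cardE => /andP[_ /(mem_nth a)]; rewrite mem_enum.
have mAf a : a \in D -> a \in Af (f a).
  by rewrite !inE mem_enum inE eqxx andbT => /andP[].
have gh a : a \in D -> g (h a) = f a.
  by move/hin; rewrite inE => /andP[_ /eqP].
have injh : {in D &, injective h}.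
  move=> a b aD bD E; have Ef : f a = f b by rewrite -gh // E gh.
  move: E (aD) (bD); rewrite /h Ef !inE Ef [#|_|]cardE => /eqP.
  move=> E /andP[_ ia] /andP[_ ib].
  move: E; rewrite (set_nth_default b a) // nth_uniq ?enum_uniq // => /eqP E.
  by rewrite -(nth_index a (mAf a aD)) Ef E -Ef nth_index // Ef mAf.
have [s sE] := perm_extension injh.
have matchD a : a \in D -> key_matched A B f g s a.
  move=> aD; have := hin a aD; rewrite /key_matched sE // inE => /andP[-> ->].
  by move: aD; rewrite inE => /andP[->].
exists s; split=> k.
  apply: leq_trans (card_index_ge _ _); apply: subset_leq_card.
  apply/subsetP => a; rewrite !inE => /andP[/andP[aA aN] /eqP fa].
  rewrite aA fa eqxx /= leqNgt; apply: contra aN => lt.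
  by apply: matchD; rewrite inE aA fa.
apply: leq_trans (card_index_ge _ _); apply: subset_leq_card.
apply/subsetP => b; rewrite !inE => /andP[/andP[bB bN] /eqP gb].
rewrite bB gb eqxx /= leqNgt; apply: contra bN => lt.
pose a := nth b (Af k) (index b (Bg k)).
have lt' : (index b (Bg k) < size (Af k))%N by rewrite -cardE.
have : a \in fiber A f k by rewrite -mem_enum mem_nth.
rewrite inE => /andP[aA /eqP fa].
have bk : b \in Bg k by rewrite mem_enum inE bB gb eqxx.
have ia : index a (Af k) = index b (Bg k) by rewrite index_uniq ?enum_uniq.
have aD : a \in D by rewrite inE aA fa ia cardE index_mem.
have <- : s a = b by rewrite sE // /h fa ia nth_index.
by rewrite key_matchedV matchD.
Qed.

Lemma card_sum_fiber (T K : finType) (C : {set T}) (f : T -> K) :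
  #|C| = (\sum_k #|[set c in C | f c == k]|)%N.
Proof.
rewrite -sum1_card (partition_big f xpredT) //=; apply: eq_bigr => k _.
by rewrite -sum1dep_card.
Qed.

Lemma sum_option (T : finType) (V : nmodType) (F : option T -> V) :
  \sum_o F o = F None + \sum_x F (Some x).
Proof.
rewrite (bigD1 None) //=; congr (_ + _).
by rewrite (reindex_omap Some id) //=; [apply: eq_bigl => x; rewrite eqxx|case].
Qed.

Lemma ler_natB (R : realDomainType) (m n : nat) :
  ((m - n)%N%:R : R) <= `|m%:R - n%:R|.
Proof.
have [le|/ltnW le] := leqP n m; first by rewrite natrB // ler_norm.
by rewrite (eqP (_ : (m - n)%N == 0%N)) ?subn_eq0 // normr_ge0.
Qed.

(** * Counting pieces by anchor, type and class of the anchor *)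

Section Counts.
Variables (R : realType) (T PT CL : finType) (est : CL -> PT -> R).
Implicit Types (A H : {set T}) (rt : T -> option T) (ty : T -> PT) (cl : T -> CL).

(** In the application [A] holds one representative per small piece, [rt] gives the high-degree
    vertex it hangs from, if any, and [ty] its kind; [est c t] estimates how many pieces of kind [t]
    hang from a vertex of class [c]. *)
Definition key_count A rt ty (o : option T) (t : PT) : nat :=
  #|[set a in A | (rt a == o) && (ty a == t)]|.

(** High-degree vertices are too few to be hit by uniform sampling, so a class is measured by the
    number of pieces that hang from its members. *)
Definition class_weight A rt cl (c : CL) : nat :=
  #|[set a in A | oapp (fun r => cl r == c) false (rt a)]|.

Definition est_error A rt ty cl (r : T) : R :=
  \sum_t `|(key_count A rt ty (Some r) t)%:R - est (cl r) t|.

Lemma est_error_ge0 A rt ty cl r : 0 <= est_error A rt ty cl r.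
Proof. by apply: sumr_ge0 => t _; rewrite normr_ge0. Qed.

Lemma class_weightE A H rt ty cl c :
  (forall a r, a \in A -> rt a = Some r -> r \in H) ->
  class_weight A rt cl c =
  (\sum_(r in fiber H cl c) \sum_t key_count A rt ty (Some r) t)%N.
Proof.
move=> rtH; rewrite /class_weight (card_sum_fiber _ rt) sum_option /=.
rewrite [X in (X + _)%R](_ : _ = 0%N); last first.
  apply/eqP; rewrite cards_eq0; apply/eqP/setP => a; rewrite !inE.
  by apply/negbTE/negP => /andP[/andP[_ +] /eqP E]; rewrite E.
rewrite add0r [RHS]big_mkcond /=; apply: eq_bigr => r _.
rewrite inE; case: ifP => [/andP[rH /eqP rc]|rNH]; last first.
  apply/eqP; rewrite cards_eq0; apply/eqP/setP => a; rewrite !inE.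
  apply/negbTE/negP => /andP[/andP[aA +] /eqP E]; rewrite E /= => rc.
  by rewrite rc (rtH _ _ aA E) in rNH.
rewrite (card_sum_fiber _ ty); apply: eq_bigr => t _; apply: eq_card => a.
rewrite !inE; case: (a \in A) => //=; case: eqVneq => [->|]; rewrite ?andbF //=.
by rewrite rc eqxx.
Qed.

(** The weight of a class is the sum of the piece counts of its members, each of them close to
    [est c]. Weights thereby control the number of members of a class, which is not sampled
    itself. *)
Lemma class_weight_est A H rt ty cl c :
  (forall a r, a \in A -> rt a = Some r -> r \in H) ->
  `|(class_weight A rt cl c)%:R - #|fiber H cl c|%:R * \sum_t est c t|
    <= \sum_(r in fiber H cl c) est_error A rt ty cl r.
Proof.
move=> rtH; rewrite (class_weightE ty cl c rtH) natr_sum -sum1_card natr_sum.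
rewrite mulr_suml -sumrB; apply: le_trans (ler_norm_sum _ _ _) _.
apply: ler_sum => r; rewrite inE => /andP[_ /eqP rc].
rewrite mul1r natr_sum -sumrB; apply: le_trans (ler_norm_sum _ _ _) _.
by rewrite /est_error rc.
Qed.

End Counts.

Lemma sum_fiber (R : numDomainType) (T K : finType) (H : {set T}) (f : T -> K)
    (F : T -> R) :
  \sum_k \sum_(r in fiber H f k) F r = \sum_(r in H) F r.
Proof.
rewrite [RHS](partition_big f xpredT) //=; apply: eq_bigr => k _.
by apply: eq_bigl => r; rewrite inE.
Qed.

(** Free pieces remain unmatched only where the counts by type differ. Pieces at a high-degree
    vertex that is paired within its class are lost only through the errors of the two estimates. An
    unpaired vertex may lose all its pieces, but the surplus of such vertices in a class shows up in
    the class weights. *)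
Lemma unmatched_bound (R : realType) (T PT CL : finType) (est : CL -> PT -> R)
    (A A' H H' U : {set T}) (rt rt' : T -> option T) (ty ty' : T -> PT)
    (cl cl' : T -> CL) (rho : {perm T}) :
  (forall c t, 0 <= est c t) ->
  (forall a r, a \in A -> rt a = Some r -> r \in H) ->
  (forall a r, a \in A' -> rt' a = Some r -> r \in H') ->
  U \subset A ->
  (forall t, key_count U rt ty None t
     <= key_count A rt ty None t - key_count A' rt' ty' None t)%N ->
  (forall r t, key_count U rt ty (Some r) t
     <= key_count A rt ty (Some r) t - key_count A' rt' ty' (Some (rho r)) t)%N ->
  (forall c, #|fiber (unmatched H H' cl cl' rho) cl c|
     <= #|fiber H cl c| - #|fiber H' cl' c|)%N ->
  (#|U|%:R : R) <=
    \sum_t `|(key_count A rt ty None t)%:R - (key_count A' rt' ty' None t)%:R|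
    + \sum_c `|(class_weight A rt cl c)%:R - (class_weight A' rt' cl' c)%:R|
    + 2 * \sum_(r in H) est_error est A rt ty cl r
    + 2 * \sum_(r in H') est_error est A' rt' ty' cl' r.
Proof.
move=> est0 rtH rtH' /subsetP sUA hnone hsome hcl.
set E := est_error est A rt ty cl; set E' := est_error est A' rt' ty' cl'.
have E0 r : 0 <= E r by apply: est_error_ge0.
have E0' r : 0 <= E' r by apply: est_error_ge0.
have -> : #|U| = (\sum_t key_count U rt ty None t
                  + \sum_r \sum_t key_count U rt ty (Some r) t)%N.
  rewrite (card_sum_fiber U rt) sum_option /=; congr (_ + _)%N.
    rewrite (card_sum_fiber _ ty); apply: eq_bigr => t _.
    by apply: eq_card => a; rewrite !inE andbA.
  apply: eq_bigr => r _; rewrite (card_sum_fiber _ ty); apply: eq_bigr => t _.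
  by apply: eq_card => a; rewrite !inE andbA.
rewrite natrD.
have leN : (\sum_t key_count U rt ty None t)%:R <=
  \sum_t `|(key_count A rt ty None t)%:R - (key_count A' rt' ty' None t)%:R| :> R.
  rewrite natr_sum; apply: ler_sum => t _.
  by apply: le_trans (ler_natB _ _ _); rewrite ler_nat.
pose M := unmatched H H' cl cl' rho.
pose e c := \sum_t est c t.
have e0 c : 0 <= e c by apply: sumr_ge0.
(* For a paired [r] both counts are compared with their common estimate; for an unpaired one the
   whole count is at most the estimate plus its error. *)
have leS r : (\sum_t key_count U rt ty (Some r) t)%:R <=
  (if r \in H then E r else 0) + (if rho r \in H' then E' (rho r) else 0)
  + (if r \in M then e (cl r) else 0) :> R.
  case: (boolP (r \in H)) => rH; last first.
    rewrite big1 ?addr_ge0 //; [by case: ifP|by case: ifP|].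
    move=> t _; apply/eqP; rewrite cards_eq0; apply/eqP/setP => a; rewrite !inE.
    apply/negbTE/negP => /and3P[/sUA aA /eqP ra _].
    by rewrite (rtH _ _ aA ra) in rH.
  rewrite natr_sum inE rH /=; case: (boolP (key_matched _ _ _ _ _ _)) => /=.
    case/and3P => _ rH' /eqP clr; rewrite rH' addr0 -big_split /=.
    apply: ler_sum => t _; apply: (@le_trans _ _ (key_count A rt ty (Some r) t
      - key_count A' rt' ty' (Some (rho r)) t)%N%:R); first by rewrite ler_nat.
    apply: le_trans (ler_natB _ _ _) _; rewrite clr.
    by rewrite [X in _ <= _ + X]distrC; apply: ler_distD.
  move=> _; apply: (@le_trans _ _ (E r + e (cl r))); last first.
    by rewrite lerD2r lerDl; case: ifP.
  rewrite -big_split /=; apply: ler_sum => t _.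
  apply: (@le_trans _ _ (key_count A rt ty (Some r) t)%:R).
    by rewrite ler_nat (leq_trans (hsome r t)) ?leq_subr.
  by rewrite -lerBlDr ler_norm.
(* In class [c] the surplus of members times [e c] is the difference of the two products in
   [class_weight_est], which is compared with the difference of the weights. *)
have leM : \sum_(r in M) e (cl r) <=
    \sum_c `|(class_weight A rt cl c)%:R - (class_weight A' rt' cl' c)%:R|
    + \sum_(r in H) E r + \sum_(r in H') E' r :> R.
  rewrite -(sum_fiber M cl) -(sum_fiber H cl) -(sum_fiber H' cl') -!big_split /=.
  apply: ler_sum => c _.
  rewrite (eq_bigr (fun=> e c)); last by move=> r; rewrite inE => /andP[_ /eqP->].
  rewrite sumr_const -(mulr_natl (e c)).
  have h1 := class_weight_est est ty cl c rtH.
  have h2 := class_weight_est est ty' cl' c rtH'.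
  have [le|lt] := leqP #|fiber H cl c| #|fiber H' cl' c|.
    have := hcl c; rewrite (eqP (_ : _ - _ == 0)%N) ?subn_eq0 // leqn0 => /eqP->.
    by rewrite mul0r !addr_ge0 ?normr_ge0 ?sumr_ge0.
  have h3 : #|fiber M cl c|%:R * e c <=
      (#|fiber H cl c|%:R - #|fiber H' cl' c|%:R) * e c.
    by apply: ler_wpM2r => //; rewrite -natrB ?ler_nat ?hcl // ltnW.
  apply: le_trans h3 _; rewrite mulrBl.
  set x := _ * e c; set y := _ * e c.
  move: h1 h2; rewrite -/(e c) -/x -/y -/E -/E'.
  set w := (class_weight A _ _ _)%:R; set w' := (class_weight A' _ _ _)%:R.
  move=> h1 h2.
  have -> : x - y = (x - w) + (w - w') + (w' - y) by ring.
  have := ler_norm (w - w'); have := ler_norm (w' - y).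
  have : x - w <= `|w - x| by rewrite distrC ler_norm.
  by lra.
have sumS : (\sum_r \sum_t key_count U rt ty (Some r) t)%:R <=
    \sum_(r in H) E r + \sum_(r in H') E' r + \sum_(r in M) e (cl r) :> R.
  rewrite natr_sum; apply: le_trans (ler_sum _ (fun r _ => leS r)) _.
  rewrite !big_split /= -!big_mkcond /= !lerD2r lerD2l.
  by rewrite [leRHS](reindex_inj (@perm_inj _ rho)).
lra.
Qed.

(** * Averages over random seeds *)

Definition avg (R : realType) (X : finType) (f : X -> R) : R :=
  (\sum_x f x) / #|X|%:R.

Section Avg.
Variable R : realType.

Lemma eq_avg (X : finType) (f g : X -> R) : f =1 g -> avg f = avg g.
Proof. by move=> fg; congr (_ / _); apply: eq_bigr => x _. Qed.

Lemma avg_le (X : finType) (f g : X -> R) :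
  (forall x, f x <= g x) -> avg f <= avg g.
Proof. by move=> fg; rewrite ler_wpM2r ?invr_ge0 ?ler0n // ler_sum. Qed.

Lemma avgD (X : finType) (f g : X -> R) :
  avg (fun x => f x + g x) = avg f + avg g.
Proof. by rewrite /avg big_split mulrDl. Qed.

Lemma avgZ (X : finType) (a : R) (f : X -> R) :
  avg (fun x => a * f x) = a * avg f.
Proof. by rewrite /avg -mulr_sumr mulrA. Qed.

Lemma avg_sum (X I : finType) (P : pred I) (F : I -> X -> R) :
  avg (fun x => \sum_(i | P i) F i x) = \sum_(i | P i) avg (F i).
Proof. by rewrite /avg exchange_big mulr_suml. Qed.

Lemma avg_cst (X : finType) (a : R) : (0 < #|X|)%N -> avg (fun _ : X => a) = a.
Proof.
by move=> X0; rewrite /avg sumr_const -(mulr_natr a) mulfK // pnatr_eq0 -lt0n.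
Qed.

Lemma avg_pred (X : finType) (P : pred X) :
  avg (fun x => (P x)%:R) = #|[set x | P x]|%:R / #|X|%:R :> R.
Proof. by rewrite /avg -natr_sum -sum1dep_card [in RHS]big_mkcond. Qed.

Lemma avg_pair (X Y : finType) (f : X * Y -> R) :
  avg f = avg (fun x => avg (fun y => f (x, y))).
Proof.
rewrite /avg -mulr_suml -mulrA -invfM card_prod natrM mulrC [in RHS]mulrC.
congr (_ * _); first by rewrite mulrC.
by rewrite pair_big; apply: eq_bigr => -[].
Qed.

(** This is the independence of the coordinates of a uniform random function. Marginals follow by
    taking the factor 1 at all other coordinates. *)
Lemma avg_ffun_prod (I X : finType) (F : I -> X -> R) :
  avg (fun g : {ffun I -> X} => \prod_i F i (g i)) = \prod_i avg (F i).
Proof.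
rewrite /avg -bigA_distr_bigA big_split /= prodr_const.
by rewrite card_ffun natrX exprVn.
Qed.

Lemma avg_coord (I X : finType) (i : I) (f : X -> R) : (0 < #|X|)%N ->
  avg (fun g : {ffun I -> X} => f (g i)) = avg f.
Proof.
move=> X0; pose F j := if j == i then f else fun=> 1.
rewrite (@eq_avg _ _ (fun g : {ffun I -> X} => \prod_j F j (g j))).
  rewrite avg_ffun_prod (bigD1 i) //= /F eqxx big1 ?mulr1 // => j /negPf ->.
  exact: avg_cst.
by move=> g; rewrite (bigD1 i) //= /F eqxx big1 ?mulr1 // => j /negPf ->.
Qed.

Lemma avg_coord2 (I X : finType) (i j : I) (f h : X -> R) : (0 < #|X|)%N ->
  i != j ->
  avg (fun g : {ffun I -> X} => f (g i) * h (g j)) = avg f * avg h.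
Proof.
move=> X0 ij; have ji : (j == i) = false by rewrite eq_sym (negPf ij).
pose F l := if l == i then f else if l == j then h else fun=> 1.
rewrite (@eq_avg _ _ (fun g : {ffun I -> X} => \prod_l F l (g l))).
  rewrite avg_ffun_prod (bigD1 i) //= (bigD1 j) /= ?ji //.
  rewrite /F !eqxx ji big1 ?mulr1 // => l /andP[/negPf -> /negPf ->].
  exact: avg_cst.
move=> g; rewrite (bigD1 i) //= (bigD1 j) /= ?ji //.
by rewrite /F !eqxx ji big1 ?mulr1 // => l /andP[/negPf -> /negPf ->].
Qed.

(** The mixed terms vanish because distinct coordinates are independent and centred. *)
Lemma avg_sum_sqr (I X : finType) (y : X -> R) : (0 < #|X|)%N -> avg y = 0 ->
  avg (fun g : {ffun I -> X} => (\sum_i y (g i)) ^+ 2)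
  = #|I|%:R * avg (fun x => y x ^+ 2).
Proof.
move=> X0 y0.
rewrite (@eq_avg _ _ (fun g : {ffun I -> X} =>
  \sum_i \sum_j y (g i) * y (g j))); last first.
  by move=> g; rewrite expr2 mulr_suml; apply: eq_bigr => i _; rewrite mulr_sumr.
rewrite avg_sum -[#|I|]sum1_card natr_sum mulr_suml; apply: eq_bigr => i _.
rewrite avg_sum (bigD1 i) //= big1 ?addr0 => [|j ji].
  by rewrite mul1r -(avg_coord i (fun x => y x ^+ 2) X0).
by rewrite avg_coord2 1?eq_sym // y0 mul0r.
Qed.

(** An indicator has variance at most 1, so the empirical mean of [m ^ 2] samples has variance at
    most the square of [1 / m]. *)
Lemma avg_frequency (X : finType) (P : pred X) (m : nat) :
  (0 < #|X|)%N -> (0 < m)%N ->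
  avg (fun g : {ffun 'I_(m ^ 2) -> X} =>
    `|#|[set j | P (g j)]|%:R / (m ^ 2)%:R - #|[set x | P x]|%:R / #|X|%:R|)
  <= m%:R^-1 :> R.
Proof.
move=> X0 m0; set p := _ / #|X|%:R.
pose y x : R := (P x)%:R - p.
have m0' : 0 < m%:R :> R by rewrite ltr0n.
have avgp : avg (fun x => (P x)%:R) = p by rewrite avg_pred.
have y0 : avg y = 0.
  by rewrite /y (avgD (fun x => (P x)%:R) (fun=> - p)) avgp avg_cst // subrr.
have y2 : avg (fun x => y x ^+ 2) <= 1.
  rewrite -(avg_cst 1 X0); apply: avg_le => x.
  have p0 : 0 <= p by rewrite divr_ge0.
  have p1 : p <= 1 by rewrite ler_pdivrMr ?ltr0n // mul1r ler_nat max_card.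
  by rewrite /y expr2; case: (P x) => /=; nra.
(* The first moment is bounded by the second through [2 * |t| <= m * t ^ 2 + 1 / m], where [t] is
   the sum divided by [m ^ 2]. *)
apply: (@le_trans _ _ (avg (fun g : {ffun 'I_(m ^ 2) -> X} =>
    (2 * m%:R ^+ 3)^-1 * (\sum_j y (g j)) ^+ 2 + (2 * m%:R)^-1))).
  apply: avg_le => g.
  have -> : #|[set j | P (g j)]|%:R / (m ^ 2)%:R - p
            = (\sum_j y (g j)) / m%:R ^+ 2.
    rewrite /y sumrB sumr_const card_ord -(mulr_natr p) natrX mulrBl mulfK; last first.
      by rewrite expf_neq0 // gt_eqF.
    by congr (_ / _ - _); rewrite -natr_sum -sum1dep_card big_mkcond.
  set z := \sum_j _; set a : R := m%:R.
  have -> : (2 * a ^+ 3)^-1 * z ^+ 2 + (2 * a)^-1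
          = (a * (z / a ^+ 2) ^+ 2 + a^-1) / 2 by field; rewrite gt_eqF.
  set t := z / _.
  rewrite ler_pdivlMr // -[X in X <= _]mulrC.
  rewrite -(@ler_pM2l _ a) // mulrDr mulfV ?gt_eqF //.
  have : 0 <= (a * `|t| - 1) ^+ 2 by rewrite sqr_ge0.
  have -> : t ^+ 2 = `|t| ^+ 2 by rewrite real_normK ?num_real.
  by lra.
rewrite avgD avgZ avg_sum_sqr // card_ord avg_cst; last first.
  by rewrite card_ffun expn_gt0 X0.
rewrite natrX.
have -> : (2 * m%:R ^+ 3)^-1 * (m%:R ^+ 2 * avg (fun x => y x ^+ 2)) + (2 * m%:R)^-1
  = m%:R^-1 * ((avg (fun x => y x ^+ 2) + 1) / 2) :> R by field; rewrite gt_eqF.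
by rewrite ger_pMr ?invr_gt0 //; lra.
Qed.

(** Markov's inequality, in the pointwise form that 1 is at most [f x / c] plus the indicator of
    [P]. *)
Lemma avg_markov (X : finType) (f : X -> R) (c : R) (P : pred X) :
  (0 < #|X|)%N -> 0 < c -> (forall x, 0 <= f x) -> avg f <= c / 3 ->
  (forall x, f x < c -> P x) -> 2 / 3 <= avg (fun x => (P x)%:R) :> R.
Proof.
move=> X0 c0 f0 favg fP.
have : avg (fun _ : X => 1) <= avg (fun x => c^-1 * f x + (P x)%:R).
  apply: avg_le => x; have [/fP->|le] := ltP (f x) c.
    by rewrite lerDr mulr_ge0 // invr_ge0 ltW.
  apply: (@le_trans _ _ (c^-1 * f x)); first by rewrite ler_pdivlMl ?mulr1.
  by rewrite lerDl ler0n.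
rewrite avgD avgZ avg_cst //.
have : c^-1 * avg f <= 1 / 3 by rewrite ler_pdivrMl // mulrA mulr1.
by lra.
Qed.

(** The probability is the power of [m / (m + 1)] with exponent the size of [S]; Bernoulli's
    inequality turns it into a bound inverse in that size. *)
Lemma avg_avoid0 (T : finType) (m : nat) (S : {set T}) : (0 < #|S|)%N ->
  avg (fun w : {ffun T -> 'I_m.+1} => [forall x in S, w x != ord0]%:R)
  <= m%:R / #|S|%:R :> R.
Proof.
move=> S0; have m0 : 0 < m.+1%:R :> R by rewrite ltr0n.
pose F x (c : 'I_m.+1) : R := if x \in S then (c != ord0)%:R else 1.
rewrite (@eq_avg _ _ (fun w : {ffun T -> 'I_m.+1} => \prod_x F x (w x))).
  have ->: avg (fun w : {ffun T -> 'I_m.+1} => \prod_x F x (w x))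
         = (m%:R / m.+1%:R) ^+ #|S|.
    rewrite avg_ffun_prod (bigID (mem S)) /= [X in _ * X]big1 ?mulr1; last first.
      by move=> x /negPf xS; rewrite /F xS avg_cst // card_ord.
    rewrite (eq_bigr (fun=> m%:R / m.+1%:R)) ?prodr_const // => x xS.
    rewrite /F xS avg_pred card_ord; congr (_%:R / _).
    rewrite (_ : [set c | _] = [set~ ord0]) ?cardsC1 ?card_ord //.
    by apply/setP => c; rewrite !inE.
  set s := #|S| in S0 *; have s0 : 0 < s%:R :> R by rewrite ltr0n.
  rewrite ler_pdivlMr // expr_div_n mulrAC ler_pdivrMr ?exprn_gt0 //.
  have bern (k : nat) :
      k%:R * m%:R ^+ k <= m%:R * m.+1%:R ^+ k :> R /\
      m%:R ^+ k <= m.+1%:R ^+ k :> R.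
    elim: k => [|k [IH1 IH2]]; first by rewrite mul0r mulr_ge0 ?expr0.
    split; last by rewrite lerXn2r ?nnegrE ?ler0n // ler_nat.
    rewrite !exprS.
    have M0 : 0 <= m%:R :> R by rewrite ler0n.
    have := ler_wpM2l M0 IH1; have := ler_wpM2l M0 IH2.
    rewrite -[k.+1%:R]natr1 -[m.+1%:R]natr1; lra.
  by rewrite mulrC; case: (bern s).
move=> w; case: (boolP [forall x in S, w x != ord0]) => [/forall_inP h|].
  by rewrite big1 // => x _; rewrite /F; case: ifP => // /h ->.
by case/forall_inPn => x xS wx; rewrite (bigD1 x) //= /F xS (negPf wx) mul0r.
Qed.

End Avg.

(** When [d] divides [N], reducing a uniform index below [N] modulo [d] gives a uniform index below
    [d]. An index can thus be drawn before the degree is known. *)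
Lemma card_modn (N d : nat) (P : pred nat) : (0 < d)%N -> (d %| N)%N ->
  (#|[set x : 'I_N | P (x %% d)%N]| * d = #|[set i : 'I_d | P i]| * N)%N.
Proof.
move=> d0 /dvdnP[q ->]; rewrite mulnA [(_ * q)%N]mulnC; congr (_ * _)%N.
have cardE n (Q : pred nat) : #|[set x : 'I_n | Q x]| = (\sum_(0 <= x < n) Q x)%N.
  by rewrite -sum1dep_card big_mkcond big_mkord.
have -> := cardE (q * d)%N (fun x => P (x %% d)%N); rewrite (cardE _ P).
elim: q => [|q IHq]; first by rewrite mul0n big_geq.
rewrite mulSn addnC (big_cat_nat (n := q * d)) //= ?leq_addr // IHq mulSn addnC.
congr (_ + _)%N; rewrite -{1}[(q * d)%N]add0n big_addn addKn.
by apply: eq_big_nat => i /andP[_ lt]; rewrite addnC modnMDl modn_small.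
Qed.

(** * Cutting a forest into small pieces *)

Section Pieces.
Variables (T : finType) (G : sgraph T) (D k : nat) (unc : pred T).

Definition low (u : T) : bool := (degree G u < D)%N.

Definition kept (u v : T) : bool := [&& G u v, low u, low v, unc u & unc v].

Definition cell (v : T) : {set T} := [set w | connect kept v w].

Definition small (v : T) : bool := (#|cell v| <= k)%N.

Definition high_edges (v : T) : {set T * T} :=
  [set p | [&& p.1 \in cell v, G p.1 p.2 & ~~ low p.2]].

(* A small piece joined to the high-degree vertices by exactly one edge hangs
   from that edge; its anchor is the high endpoint. *)
Definition anchor (v : T) : option T := [pick r | high_edges v == [set (v, r)]].

(** This selects one vertex in each small cell of low vertices: the low endpoint of its edge to a
    high vertex if there is just one such edge, and the first enumerated vertex otherwise. In the
    first case, pairing representatives preserves the point of attachment. *)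
Definition isrep (v : T) : bool :=
  [&& low v, small v &
      (anchor v != None) ||
      ((#|high_edges v| != 1%N) && (v == head v (enum (cell v))))].

Definition piece (v : T) : seq T := v :: enum (cell v :\ v).

Definition piece_type := ('I_k.+1 * {ffun 'I_k * 'I_k -> bool})%type.

(** The matrix is written in the order of [piece v], which begins with [v]. Equality of types
    therefore means that sending the i-th vertex to the i-th vertex is an isomorphism of pieces
    fixing the role of the representative. *)
Definition ty (v : T) : piece_type :=
  (inord #|cell v|,
   [ffun ij : 'I_k * 'I_k => kept (nth v (piece v) ij.1) (nth v (piece v) ij.2)]).

Lemma keptC : symmetric kept.
Proof.
by move=> u v; rewrite /kept edge_sym; case: (G v u); case: (low u);
  case: (low v); case: (unc u); case: (unc v).
Qed.

Lemma mem_cell v : v \in cell v.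
Proof. by rewrite inE connect0. Qed.

Lemma cell_eq v w : w \in cell v -> cell w = cell v.
Proof.
rewrite inE => vw; apply/setP => x; rewrite !inE.
by rewrite (same_connect (sym_connect_sym keptC) vw).
Qed.

Lemma cell_kept v w : kept v w -> cell w = cell v.
Proof. by move=> vw; apply: cell_eq; rewrite inE connect1. Qed.

Lemma cell_low v w : low v -> w \in cell v -> low w.
Proof.
move=> lv; rewrite inE => /connectP[p + ->] {w}.
by elim: p v lv => //= x p IHp v lv /andP[/and3P[_ _ /andP[lx _]] /IHp]; apply.
Qed.

Lemma high_edges_eq v w : cell w = cell v -> high_edges w = high_edges v.
Proof. by rewrite /high_edges => ->. Qed.

Lemma small_eq v w : cell w = cell v -> small w = small v.
Proof. by rewrite /small => ->. Qed.

Lemma anchorP v r : anchor v = Some r -> high_edges v = [set (v, r)].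
Proof. by rewrite /anchor; case: pickP => // x /eqP -> [->]. Qed.

Lemma anchor_mem v u r : high_edges v = [set (u, r)] -> u \in cell v.
Proof.
by move=> E; have := set11 (u, r); rewrite -E in_set => /andP[].
Qed.

Lemma anchor_edge v r : anchor v = Some r -> G v r && ~~ low r.
Proof.
move=> /anchorP E; have := set11 (v, r); rewrite -E in_set.
by case/and3P => _ /= -> ->.
Qed.

Lemma anchor_nbr u r : anchor u != None -> G u r -> ~~ low r -> anchor u = Some r.
Proof.
case E: (anchor u) => [r'|] // _ Gur hr.
have : (u, r) \in high_edges u by rewrite in_set mem_cell Gur.
by rewrite (anchorP E) inE => /eqP[->].
Qed.

Lemma anchor_Some v r : high_edges v = [set (v, r)] -> anchor v = Some r.
Proof.
move=> E; rewrite /anchor; case: pickP => [r' /eqP|/(_ r)]; last by rewrite E eqxx.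
by rewrite E => /setP/(_ (v, r)); rewrite !inE eqxx => /esym/eqP[->].
Qed.

Lemma rep_exists v : low v -> small v -> exists2 a, isrep a & a \in cell v.
Proof.
move=> lv sv; have [/cards1P[[a r] hE]|h1] := boolP (#|high_edges v| == 1%N).
  have av := anchor_mem hE; exists a => //.
  rewrite /isrep (cell_low lv av) (small_eq (cell_eq av)) sv /=.
  by rewrite (@anchor_Some a r) // (high_edges_eq (cell_eq av)).
have av : head v (enum (cell v)) \in cell v.
  have := mem_cell v; rewrite -mem_enum -[_ \in cell v]mem_enum.
  by case: (enum _) => //= x s _; rewrite mem_head.
exists (head v (enum (cell v))) => //; set a := head _ _ in av *.
rewrite /isrep (cell_low lv av) (small_eq (cell_eq av)) sv /=.
rewrite (high_edges_eq (cell_eq av)) h1 (cell_eq av) orbC /a.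
by have := mem_cell v; rewrite -mem_enum; case: (enum _) => //= x s _; rewrite eqxx.
Qed.

Lemma rep_unique a b : isrep a -> isrep b -> cell a = cell b -> a = b.
Proof.
move=> /and3P[_ _ ra] /and3P[_ _ rb] E.
have hE := high_edges_eq E.
case Ea: (anchor a) ra => [r|] /=; case Eb: (anchor b) rb => [r'|] /=.
- move=> _ _; move: hE; rewrite (anchorP Ea) (anchorP Eb).
  by move=> /setP/(_ (a, r)); rewrite !inE eqxx => /esym/eqP[->].
- by move/anchorP: Ea => Ea; rewrite -hE Ea cards1.
- by move=> _; move/anchorP: Eb => Eb; rewrite hE Eb cards1.
- move=> /andP[_ /eqP bE] /andP[_ /eqP aE]; rewrite aE bE E.
  by have := mem_cell b; rewrite -mem_enum; case: (enum _).
Qed.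

Lemma mem_piece v w : (w \in piece v) = (w \in cell v).
Proof. by rewrite inE mem_enum !inE; case: eqVneq => //= ->; rewrite connect0. Qed.

Lemma piece_uniq v : uniq (piece v).
Proof. by rewrite /= enum_uniq mem_enum !inE eqxx. Qed.

Lemma size_piece v : size (piece v) = #|cell v|.
Proof.
rewrite -(card_uniqP (piece_uniq v)); apply: eq_card => w; exact: mem_piece.
Qed.

End Pieces.

Lemma ty_eq (T : finType) (G G' : sgraph T) (D k : nat) (unc : pred T) (a b : T) :
  small G D k unc a -> small G' D k unc b ->
  ty G D k unc a = ty G' D k unc b ->
  #|cell G D unc a| = #|cell G' D unc b| /\
  forall i j, (i < #|cell G D unc a|)%N -> (j < #|cell G D unc a|)%N ->
    kept G D unc (nth a (piece G D unc a) i) (nth a (piece G D unc a) j) =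
    kept G' D unc (nth b (piece G' D unc b) i) (nth b (piece G' D unc b) j).
Proof.
rewrite /small => sa sb [/(congr1 val) + /ffunP tE]; rewrite /= !inordK // => cE.
split=> // i j ia ja.
have := tE (Ordinal (leq_trans ia sa), Ordinal (leq_trans ja sa)).
by rewrite !ffunE.
Qed.

(** * Climbing to the top of a cell *)

Section Tops.
Variables (T : finType) (G : sgraph T) (D : nat) (unc : pred T).
Variables (par : T -> T) (rk : T -> nat).
Hypothesis rootG : rooting G par rk.

Definition step_up (x : T) : T := if kept G D unc x (par x) then par x else x.

Lemma step_up_rk x : step_up x != x -> (rk (step_up x) < rk x)%N.
Proof. by rewrite /step_up; case: ifP => [_ /(proj1 rootG)|]; rewrite ?eqxx. Qed.

Lemma iter_up_rk i x : iter i.+1 step_up x != iter i step_up x ->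
  (rk (iter i step_up x) + i <= rk x)%N.
Proof.
elim: i => [|i IHi]; first by rewrite addn0.
have [E|ne] := eqVneq (iter i.+1 step_up x) (iter i step_up x).
  by rewrite [X in X != _]iterS E -iterS E eqxx.
have lt : (rk (iter i.+1 step_up x) < rk (iter i step_up x))%N := step_up_rk ne.
by move=> _; have := IHi ne; lia.
Qed.

(** The climb has stopped after [rk x] steps, since each proper step lowers the rank. *)
Definition top (x : T) : T := iter (rk x) step_up x.

Lemma step_up_top x : step_up (top x) = top x.
Proof.
rewrite /top -iterS; apply/eqP/negPn/negP => ne.
have lt : (rk (iter (rk x).+1 step_up x) < rk (iter (rk x) step_up x))%N := step_up_rk ne.
by have := iter_up_rk ne; lia.
Qed.

Lemma iter_up_top j x : step_up (iter j step_up x) = iter j step_up x -> iter j step_up x = top x.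
Proof.
move=> fixj; have stable i y : step_up y = y -> iter i step_up y = y.
  by move=> E; elim: i => //= i ->.
have [le|/ltnW le] := leqP j (rk x).
  by rewrite /top -(subnK le) iterD [RHS]stable.
by rewrite -(subnK le) iterD stable // -/(top x) step_up_top.
Qed.

Lemma top_up x : top (step_up x) = top x.
Proof.
have E : step_up (iter (rk x) step_up (step_up x)) = iter (rk x) step_up (step_up x).
  by rewrite -iterSr iterS -/(top x) !step_up_top.
by rewrite -(iter_up_top E) -iterSr iterS -/(top x) step_up_top.
Qed.

Lemma top_kept x y : kept G D unc x y -> top x = top y.
Proof.
move=> kxy; have /andP[Gxy _] := kxy.
move: Gxy; rewrite (proj2 rootG) => /andP[_ /orP[/eqP px|/eqP py]].
  by rewrite -(top_up x) /step_up px kxy.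
by rewrite -(top_up y) /step_up py keptC kxy.
Qed.

Lemma top_connect x y : connect (kept G D unc) x y -> top x = top y.
Proof.
move=> /connectP[p + ->]; elim: p x => //= z p IHp x /andP[/top_kept -> /IHp].
by [].
Qed.

Lemma connect_up x : connect (kept G D unc) x (step_up x).
Proof. by rewrite /step_up; case: ifP => [/connect1|]. Qed.

Lemma connect_top x : connect (kept G D unc) x (top x).
Proof.
rewrite /top; elim: (rk x) => [|i IHi]; first exact: connect0.
by rewrite iterS; apply: connect_trans IHi (connect_up _).
Qed.

(** A kept edge joins a child to its parent, so [top] is constant on cells; conversely every vertex
    is connected to its own top. *)
Lemma cell_top x : cell G D unc x = [set y | top y == top x].
Proof.
apply/setP => y; rewrite !inE; apply/idP/eqP => [/top_connect //|E].
apply: connect_trans (connect_top x) _; rewrite -E.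
by rewrite (sym_connect_sym (keptC G D unc)) connect_top.
Qed.

Lemma up_fix_top x : step_up x = x -> top x = x.
Proof. by move=> E; rewrite -(@iter_up_top 0 x). Qed.

End Tops.

Lemma card_bigcup_leq (T I : finType) (A : {set I}) (F : I -> {set T}) (k : nat) :
  (forall i, i \in A -> #|F i| <= k)%N -> (#|\bigcup_(i in A) F i| <= k * #|A|)%N.
Proof.
move=> Fk; apply: (@leq_trans (\sum_(i in A) #|F i|)%N).
  elim/big_rec2: _ => [|i n U _ le]; first by rewrite cards0.
  by apply: leq_trans (leq_card_setU _ _) _; rewrite leq_add2l.
by rewrite mulnC -sum_nat_const; apply: leq_sum.
Qed.

(** * From matched pieces to a permutation of the vertices *)

Section Alignment.
Variables (T : finType) (D k : nat) (unc : pred T).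
Local Notation low G := (low G D).
Local Notation cell G := (cell G D unc).
Local Notation anchor G := (anchor G D unc).
Local Notation small G := (small G D k unc).
Local Notation isrep G := (isrep G D k unc).
Local Notation ty G := (ty G D k unc).
Local Notation piece G := (piece G D unc).

Definition piece_matched (G G' : sgraph T) (rho s : {perm T}) (a : T) : bool :=
  [&& isrep G a, isrep G' (s a), anchor G' (s a) == omap rho (anchor G a) &
      ty G' (s a) == ty G a].

Lemma piece_matchedV G G' rho s a :
  piece_matched G' G rho^-1%g s^-1%g (s a) = piece_matched G G' rho s a.
Proof.
rewrite /piece_matched permK [ty G a == _]eq_sym; case: (isrep G a) => /=;
  case: (isrep G' (s a)) => //=; congr (_ && _).
case: (anchor G a) => [r|]; case: (anchor G' (s a)) => [r'|] //=.
apply/eqP/eqP => [[->]|[->]]; by rewrite (permK, permKV).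
Qed.

Definition aligned (G G' : sgraph T) (rho s p : {perm T}) : Prop :=
  (forall r, ~~ low G r -> ~~ low G' (rho r) -> p r = rho r) /\
  (forall a i, piece_matched G G' rho s a -> (i < #|cell G a|)%N ->
     p (nth a (piece G a) i) = nth (s a) (piece G' (s a)) i).

Lemma piece_matched_card G G' rho s a : piece_matched G G' rho s a ->
  #|cell G a| = #|cell G' (s a)|.
Proof.
by case/and4P => /and3P[_ sa _] /and3P[_ sb _] _ /eqP/esym/(ty_eq sa sb)[].
Qed.

Lemma alignedV G G' rho s p :
  aligned G G' rho s p -> aligned G' G rho^-1%g s^-1%g p^-1%g.
Proof.
case=> h1 h2; split=> [r hr hr'|b i mb ib].
  by rewrite -{1}(permKV rho r) -h1 ?permK // permKV.
have [a bE] : exists a, b = s a by exists (s^-1%g b); rewrite permKV.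
move: mb ib; rewrite bE piece_matchedV permK => mb.
by rewrite -(piece_matched_card mb) => ia; rewrite -h2 // permK.
Qed.

(** The two requirements define an injection on high vertices paired with high vertices and on the
    vertices of matched pieces: cells are disjoint, and low vertices go to low ones. The rest is
    filled in by [perm_extension]. *)
Lemma aligned_exists G G' rho s : exists p, aligned G G' rho s p.
Proof.
pose repof x := odflt x [pick a | isrep G a && (a \in cell G x)].
have repofE a x : isrep G a -> x \in cell G a -> repof x = a.
  move=> ra xa; rewrite /repof; case: pickP => [b /andP[rb bx]|/(_ a)].
    by apply: rep_unique rb ra _; rewrite (cell_eq bx) (cell_eq xa).
  by rewrite ra (cell_eq xa) mem_cell.
pose E := [set x | if low G x then
    piece_matched G G' rho s (repof x) && (x \in cell G (repof x))
  else ~~ low G' (rho x)].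
pose h x := if low G x then
    nth (s (repof x)) (piece G' (s (repof x))) (index x (piece G (repof x)))
  else rho x.
have hlow x : x \in E -> low G x ->
    h x \in cell G' (s (repof x)) /\ low G' (h x).
  rewrite in_set => + lx; rewrite lx => /andP[mx xc].
  have hx : h x \in cell G' (s (repof x)).
    rewrite /h lx -mem_piece mem_nth // size_piece -(piece_matched_card mx).
    by rewrite -size_piece index_mem mem_piece.
  split=> //; apply: cell_low hx; by case/and4P: mx => _ /andP[].
have injh : {in E &, injective h}.
  move=> x y xE yE; case: (boolP (low G x)) => lx; case: (boolP (low G y)) => ly.
  - move=> hxy; have [hx _] := hlow x xE lx; have [hy _] := hlow y yE ly.
    move: (xE) (yE); rewrite [x \in E]in_set [y \in E]in_set lx ly => /andP[mx xc] /andP[my yc].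
    have sxy : s (repof x) = s (repof y).
      case/and4P: (mx) => _ rx _ _; case/and4P: (my) => _ ry _ _.
      by apply: rep_unique rx ry _; rewrite -(cell_eq hx) hxy (cell_eq hy).
    have rxy := perm_inj sxy.
    have ix : (index x (piece G (repof x)) < size (piece G' (s (repof x))))%N.
      by rewrite size_piece -(piece_matched_card mx) -size_piece index_mem mem_piece.
    have iy : (index y (piece G (repof x)) < size (piece G' (s (repof x))))%N.
      by rewrite size_piece -(piece_matched_card mx) -size_piece index_mem mem_piece rxy.
    move: hxy; rewrite /h lx ly -rxy => /eqP.
    rewrite nth_uniq ?piece_uniq // => /eqP ixy.
    rewrite -(nth_index x (s := piece G (repof x)) (x := x)) ?mem_piece // ixy.
    by rewrite nth_index // mem_piece rxy.
  - move=> hxy; have [_] := hlow x xE lx; move: yE.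
    by rewrite hxy in_set (negPf ly) /h (negPf ly) => /negPf ->.
  - move=> hxy; have [_] := hlow y yE ly; move: xE.
    by rewrite -hxy in_set (negPf lx) /h (negPf lx) => /negPf ->.
  - by rewrite /h (negPf lx) (negPf ly) => /perm_inj.
have [p pE] := perm_extension injh; exists p; split=> [r hr hr'|a i ma ia].
  by rewrite pE ?in_set /h (negPf hr).
have ra : isrep G a by case/and4P: ma.
have ia' : (i < size (piece G a))%N by rewrite size_piece.
have xa : nth a (piece G a) i \in cell G a by rewrite -mem_piece mem_nth.
have lx : low G (nth a (piece G a) i).
  by apply: cell_low xa; case/and3P: ra.
have xE : nth a (piece G a) i \in E by rewrite in_set lx (repofE a) // ma xa.
by rewrite pE // /h lx (repofE a) // index_uniq ?piece_uniq.
Qed.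

Definition high_set G : {set T} := [set v | ~~ low G v].
Definition cut_set (par : T -> T) : {set T} :=
  [set v | ~~ unc v || ~~ unc (par v)].
Definition big_set G : {set T} := [set v | low G v && ~~ small G v].

(** Such a [v] is the top of its cell. A further edge from the cell to a high vertex [h] cannot go
    up, as its lower end would be a second top; so [par h] lies in the cell. Having one parent, [h]
    determines the cell and hence [v]. *)
Lemma multi_bound G par rk : rooting G par rk ->
  (#|[set v | [&& low G v, par v != v, ~~ low G (par v) &
                  #|high_edges G D unc v| != 1%N]]| <= #|high_set G|)%N.
Proof.
move=> rootG; set S := [set v | _].
have fixv v : v \in S -> top G D unc par rk v = v.
  rewrite in_set => /and4P[_ _ hp _]; apply: (up_fix_top rootG).
  by rewrite /step_up /kept (negPf hp) !andbF.
pose hh v := odflt v [pick h | ~~ low G h && (par h \in cell G v)].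
have hhP v : v \in S -> ~~ low G (hh v) && (par (hh v) \in cell G v).
  move=> vS; rewrite /hh; case: pickP => //= none; exfalso.
  move: (vS); rewrite in_set => /and4P[lv pv hp /negP[]].
  apply/cards1P; exists (v, par v); apply/setP => -[w h]; rewrite in_set1.
  rewrite in_set /=; apply/and3P/eqP => [[wv Gwh hh']|[-> ->]]; last first.
    by split; rewrite ?mem_cell // (proj2 rootG) eq_sym pv eqxx.
  move: Gwh; rewrite (proj2 rootG) => /andP[_ /orP[/eqP pw|/eqP ph]]; last first.
    by have := none h; rewrite hh' ph wv.
  have tw : top G D unc par rk w = w.
    by apply: (up_fix_top rootG); rewrite /step_up /kept pw (negPf hh') !andbF.
  move: wv; rewrite (cell_top _ _ rootG) in_set tw (fixv v vS) => /eqP E.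
  by rewrite -pw E.
rewrite -(card_in_imset (f := hh)); last first.
  move=> v w vS wS E; rewrite -(fixv v vS) -(fixv w wS).
  have /andP[_] := hhP v vS; have /andP[_] := hhP w wS; rewrite E.
  by rewrite !(cell_top _ _ rootG) !in_set => /eqP <- /eqP.
apply: subset_leq_card; apply/subsetP => _ /imsetP[v vS ->].
by rewrite in_set; have /andP[] := hhP v vS.
Qed.

Definition lost_set (G G' : sgraph T) (par : T -> T) (p : {perm T}) : {set T} :=
  [set v | (par v != v) && ~~ G' (p v) (p (par v))].

(** A lost parent edge starts at a high vertex, or is one of those in [multi_bound], or has a marked
    end, or starts in a large cell or in an unmatched piece of at most [k] vertices. The first two
    cases each cost the number of high vertices. *)
Lemma lost_bound G G' par rk rho s p :
  rooting G par rk -> aligned G G' rho s p ->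
  (#|lost_set G G' par p| <= 2 * #|high_set G| + #|cut_set par| + #|big_set G|
     + k * #|[set a | isrep G a && ~~ piece_matched G G' rho s a]|)%N.
Proof.
move=> rootG [al1 al2]; set U := [set a | _ && _].
have le1 := multi_bound rootG; set S := [set v | _] in le1.
have le2 : (#|\bigcup_(a in U) cell G a| <= k * #|U|)%N.
  by apply: card_bigcup_leq => a; rewrite in_set => /andP[/and3P[]].
have sub : lost_set G G' par p \subset
    (high_set G :|: S) :|: cut_set par :|: big_set G :|: \bigcup_(a in U) cell G a.
  apply/subsetP => v; rewrite in_set => /andP[pv /negP lost].
  rewrite 4!in_setU -!orbA -[_ || _]negbK; apply/negP; rewrite !negb_or.
  case/and5P; rewrite [v \in high_set G]in_set negbK => lv.
  rewrite in_set pv lv /= => vS.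
  rewrite [v \in cut_set par]in_set negb_or !negbK => /andP[uv upv].
  rewrite [v \in big_set G]in_set lv negbK => sv vU; apply: lost.
  have Gv : G v (par v) by rewrite (proj2 rootG) eqxx eq_sym pv.
  have notU a : isrep G a -> v \in cell G a -> piece_matched G G' rho s a.
    move=> ra va; apply: contraR vU => nm; apply/bigcupP; exists a => //.
    by rewrite in_set ra.
  case: (boolP (low G (par v))) vS => [lpv _|hpv /=].
    have [a ra av] := rep_exists lv sv; have ca := cell_eq av.
    have kvp : kept G D unc v (par v) by rewrite /kept Gv lv lpv uv.
    have va : v \in cell G a by rewrite ca mem_cell.
    have pa : par v \in cell G a by rewrite ca -(cell_kept kvp) mem_cell.
    have ma := notU a ra va.
    case/and4P: (ma) => /and3P[_ sa _] /and3P[_ sb _] _ /eqP/esym.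
    move=> /(ty_eq sa sb)[_ keptE].
    have iv : (index v (piece G a) < #|cell G a|)%N.
      by rewrite -size_piece index_mem mem_piece.
    have ip : (index (par v) (piece G a) < #|cell G a|)%N.
      by rewrite -size_piece index_mem mem_piece.
    have := keptE _ _ iv ip; rewrite -!al2 // !nth_index ?mem_piece // kvp.
    by case/esym/andP.
  (* The parent edge is the only edge from the cell to a high vertex, so [v] is itself the
     representative and sits at index 0 of its piece; its matched image has the image of the parent
     as anchor. *)
  rewrite negbK => /cards1P[[w h] hE].
  have : (v, par v) \in high_edges G D unc v by rewrite in_set mem_cell Gv.
  rewrite hE in_set1 => /eqP[Ew Eh]; rewrite -Ew -Eh in hE.
  have rv := anchor_Some hE.
  have rep : isrep G v by apply/and3P; split=> //; rewrite rv.
  have mv := notU v rep (mem_cell _ _ _ _).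
  case/and4P: (mv) => _ _ /eqP; rewrite rv /= => /anchor_edge/andP[G'e hr] _.
  rewrite (al1 (par v)) //.
  have := al2 v 0 mv; rewrite -size_piece /= => -> //.
apply: leq_trans (subset_leq_card sub) _.
do 3!(apply: leq_trans (leq_card_setU _ _) _; apply: leq_add => //).
by apply: leq_trans (leq_card_setU _ _) _; rewrite mul2n -addnn leq_add2l.
Qed.

End Alignment.

(** Every disagreeing pair is a parent edge of one forest that is lost under [p] or under its
    inverse. *)
Lemma disagreement_bound (T : finType) (G G' : sgraph T) (par par' : T -> T)
    (rk rk' : T -> nat) (p : {perm T}) :
  rooting G par rk -> rooting G' par' rk' ->
  (#|disagreement G G' p| <= #|lost_set G G' par p| + #|lost_set G' G par' p^-1%g|)%N.
Proof.
move=> rG rG'.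
apply: (@leq_trans #|[set [set v; par v] | v in lost_set G G' par p] :|:
    [set [set p^-1%g v; p^-1%g (par' v)] | v in lost_set G' G par' p^-1%g]|); last first.
  apply: leq_trans (leq_card_setU _ _) _.
  by apply: leq_add; apply: leq_imset_card.
apply: subset_leq_card; apply/subsetP => _ /imsetP[[u v] + ->]; rewrite inE /= => E.
rewrite in_setU; case Guv: (G u v) E => /= G'uv.
  apply/orP; left; move: Guv; rewrite (proj2 rG) => /andP[uv /orP[]/eqP Ep].
    by apply/imsetP; exists u; rewrite ?inE Ep // eq_sym uv.
  apply/imsetP; exists v; last by rewrite Ep setUC.
  by rewrite inE Ep uv /= edge_sym.
apply/orP; right; move: G'uv; rewrite (proj2 rG') => /andP[uv /orP[]/eqP Ep].
  apply/imsetP; exists (p u); last by rewrite Ep !permK.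
  by rewrite inE Ep !permK Guv eq_sym uv.
apply/imsetP; exists (p v); last by rewrite Ep !permK setUC.
by rewrite inE Ep !permK edge_sym Guv uv.
Qed.

(** * Expected cost of the cuts *)

Section Percolation.
Variables (T : finType) (G : sgraph T) (par : T -> T) (rk : T -> nat) (D : nat).
Hypothesis rootG : rooting G par rk.

Lemma high_set_bound : (#|high_set D G| * D <= 2 * #|T|)%N.
Proof.
rewrite -sum_nat_const; apply: leq_trans (sum_degree rootG).
rewrite [leqRHS](bigID (mem (high_set D G))) /=.
apply: leq_trans (leq_addr _ _); apply: leq_sum => v.
by rewrite inE /low -leqNgt.
Qed.

Lemma avg_cut_set (R : realType) (m : nat) :
  avg (fun w : {ffun T -> 'I_m.+1} =>
         #|cut_set (fun x => w x != ord0) par|%:R) <= 2 * #|T|%:R / m.+1%:R :> R.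
Proof.
have coord x : avg (fun w : {ffun T -> 'I_m.+1} => (w x == ord0)%:R)
    = m.+1%:R^-1 :> R.
  rewrite (avg_coord x (fun c : 'I_m.+1 => (c == ord0)%:R)) ?card_ord //.
  rewrite avg_pred card_ord (_ : [set c | _] = [set ord0]) ?cards1 ?mul1r //.
  by apply/setP => c; rewrite !inE.
apply: (@le_trans _ _ (avg (fun w : {ffun T -> 'I_m.+1} =>
    \sum_v ((w v == ord0)%:R + (w (par v) == ord0)%:R)))).
  apply: avg_le => w; rewrite -sum1dep_card big_mkcond natr_sum.
  apply: ler_sum => v _; rewrite !negbK.
  by case: (w v == ord0); case: (w (par v) == ord0); rewrite /=; lra.
rewrite avg_sum (eq_bigr (fun=> m.+1%:R^-1 + m.+1%:R^-1)) => [|v _]; last first.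
  by rewrite avgD !coord.
rewrite sumr_const -[X in X <= _]mulr_natl.
rewrite [leLHS](_ : _ = #|T|%:R * (m.+1%:R^-1 + m.+1%:R^-1)) //.
by move: (m.+1%:R^-1) => c; lra.
Qed.

Section Chains.
Variables (unc : pred T) (j : nat).
Local Notation up := (step_up G D unc par).

(** A low [u] has fewer than [D] neighbours; the extra unit accounts for [u] itself as a fixed
    point. *)
Lemma card_up_preim u : (#|[set x | up x == u]| <= D.+1)%N.
Proof.
apply: (@leq_trans #|u |: [set x | kept G D unc u x]|).
  apply: subset_leq_card; apply/subsetP => x; rewrite !inE /step_up.
  by case: ifP => [kx /eqP <-|_ ->//]; rewrite keptC kx orbT.
apply: leq_trans (leq_card_setU _ _) _; rewrite cards1 add1n ltnS.
case: (boolP (low G D u)) => lu.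
  apply: leq_trans (ltnW lu); apply: subset_leq_card.
  by apply/subsetP => x; rewrite !inE => /andP[].
rewrite (eq_card0 (A := [set x | _])) // => x; rewrite !inE /kept (negPf lu).
by rewrite !andbF.
Qed.

Lemma card_iter_up_preim u i : (#|[set x | iter i up x == u]| <= D.+1 ^ i)%N.
Proof.
elim: i u => [|i IHi] u.
  by rewrite expn0 -(cards1 u); apply: subset_leq_card; apply/subsetP=> x; rewrite !inE.
apply: (@leq_trans #|\bigcup_(y in [set y | up y == u]) [set x | iter i up x == y]|).
  apply: subset_leq_card; apply/subsetP => x; rewrite inE /= => ux.
  by apply/bigcupP; exists (iter i up x); rewrite inE.
apply: leq_trans (card_bigcup_leq (k := D.+1 ^ i) _) _ => //.
by rewrite expnSr leq_mul2l card_up_preim orbT.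
Qed.

Definition deep (x : T) : bool := up (iter j up x) != iter j up x.

(** The chain follows [par] rather than [step_up], so it does not depend on the random marks; for a
    deep [x] the two climbs agree on it. *)
Definition chain (x : T) : {set T} := [set iter i par x | i : 'I_j.+1].

Lemma deep_step x i : deep x -> (i <= j)%N -> up (iter i up x) != iter i up x.
Proof.
move=> dx le; apply: contra dx => /eqP E; rewrite /deep.
have stable l : iter l up (iter i up x) = iter i up x by elim: l => //= l ->.
by rewrite -(subnK le) iterD stable E.
Qed.

Lemma deep_chain x i : deep x -> (i <= j)%N ->
  [/\ iter i up x = iter i par x, unc (iter i par x) &
      (rk (iter i.+1 par x) < rk (iter i par x))%N].
Proof.
move=> dx; elim: i => [|i IHi] le.
  have := deep_step dx le; rewrite /= /step_up; case: ifP; last by rewrite eqxx.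
  by move=> /and5P[_ _ _ ux _] /(proj1 rootG).
have [E1 _ _] := IHi (ltnW le); have := deep_step dx (ltnW le).
have := deep_step dx le; rewrite !iterS E1.
set y := iter i par x; have [->|ny] := eqVneq (up y) (par y); last first.
  by move=> _; rewrite {1}/step_up; move: ny; rewrite /step_up; case: ifP; rewrite eqxx.
rewrite /step_up; case: ifP; last by rewrite eqxx.
by move=> /and5P[_ _ _ ux _] /(proj1 rootG) ? _; split.
Qed.

Lemma deep_card x : deep x -> #|chain x| = j.+1.
Proof.
move=> dx; rewrite card_imset ?card_ord // => a b.
have dec p q : (p < q <= j)%N -> (rk (iter q par x) < rk (iter p par x))%N.
  elim: q => // q IHq /andP[]; rewrite ltnS leq_eqVlt => /orP[/eqP ->|pq] qj.
    by have [] := deep_chain dx (ltnW qj).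
  have [_ _ lt] := deep_chain dx (ltnW qj); apply: leq_trans lt _.
  by apply: ltnW; apply: IHq; rewrite pq ltnW.
move=> E; apply/val_inj => /=; have la := leq_ord a; have lb := leq_ord b.
by case: (ltngtP a b) => // lt; [have := dec a b|have := dec b a];
  rewrite lt ?la ?lb E ltnn => /(_ isT).
Qed.

(* A cell that is not deep lies within [j] steps below its top, which leaves
   room for at most [D.+1 ^ j] of its vertices; and at most [#|T| / k] tops
   have a cell of more than [k] vertices. *)
Lemma big_set_bound (k : nat) :
  (k * #|big_set D k unc G| <=
     k * #|[set x | deep x]| + D.+1 ^ j * #|T|)%N.
Proof.
pose tp := top G D unc par rk.
pose B := [set u | (tp u == u) && (k < #|cell G D unc u|)%N].
have kB : (k * #|B| <= #|T|)%N.
  rewrite -[X in (_ <= X)%N]sum1_card (partition_big tp xpredT) //=.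
  apply: (@leq_trans (\sum_(u in B) \sum_(x | tp x == u) 1)%N); last first.
    by rewrite [leqRHS](bigID (mem B)) /= leq_addr.
  rewrite mulnC -sum_nat_const; apply: leq_sum => u; rewrite inE => /andP[/eqP tu].
  rewrite (cell_top _ _ rootG) -/tp tu => /ltnW le; apply: leq_trans le _.
  by rewrite sum1dep_card.
have sub : big_set D k unc G \subset
    [set x | deep x] :|: \bigcup_(u in B) [set x | iter j up x == u].
  apply/subsetP => x; rewrite !inE -ltnNge => /andP[_ bx].
  case: (boolP (deep x)) => //=; rewrite /deep negbK => /eqP fx.
  have E := iter_up_top rootG fx; apply/bigcupP; exists (tp x); rewrite inE ?E //.
  have tt : tp (tp x) = tp x by rewrite /tp (up_fix_top rootG) // (step_up_top _ _ rootG).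
  by rewrite tt eqxx (cell_top _ _ rootG) -/tp tt -(cell_top _ _ rootG).
have := subset_leq_card sub; rewrite -(leq_add2l 0) !add0n => le.
apply: leq_trans (leq_mul (leqnn k) (leq_trans le (leq_card_setU _ _))) _.
rewrite mulnDr leq_add2l; apply: leq_trans (leq_mul (leqnn k) (card_bigcup_leq
  (k := D.+1 ^ j) _)) _ => [u _|]; first exact: card_iter_up_preim.
by rewrite mulnCA leq_mul2l kB orbT.
Qed.

End Chains.

(** A vertex is deep only if all [j.+1] vertices of its fixed chain are unmarked, which [avg_avoid0]
    makes unlikely. The other vertices of large cells are bounded for every choice of marks by
    [big_set_bound]. *)
Lemma avg_big_set (R : realType) (m j k : nat) : (0 < k)%N ->
  avg (fun w : {ffun T -> 'I_m.+1} =>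
         #|big_set D k (fun x => w x != ord0) G|%:R)
  <= #|T|%:R * (m%:R / j.+1%:R) + D.+1%:R ^+ j * #|T|%:R / k%:R :> R.
Proof.
move=> k0; have k0' : 0 < k%:R :> R by rewrite ltr0n.
pose dp (w : {ffun T -> 'I_m.+1}) := deep (fun x => w x != ord0) j.
apply: (@le_trans _ _ (avg (fun w : {ffun T -> 'I_m.+1} =>
    (\sum_x (dp w x)%:R) + D.+1%:R ^+ j * #|T|%:R / k%:R))).
  apply: avg_le => w; rewrite -(ler_pM2l k0').
  rewrite mulrDr [X in _ + X]mulrC divfK ?gt_eqF // -natrX -!natrM -natr_sum.
  rewrite -natrM -natrD ler_nat; apply: leq_trans (big_set_bound _ j k) _.
  by rewrite leq_add2r leq_mul2l -sum1dep_card big_mkcond leqnn orbT.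
rewrite avgD avg_cst ?card_ffun ?expn_gt0 ?card_ord // lerD2r avg_sum.
rewrite -[#|T|]sum1_card natr_sum mulr_suml; apply: ler_sum => x _; rewrite mul1r.
(* If the ancestors repeat because a root is reached too early, [x] is never deep. *)
have [Ec|Ec] := eqVneq #|chain j x| j.+1; last first.
  rewrite (@eq_avg _ _ _ (fun=> 0)) ?avg_cst ?card_ffun ?expn_gt0 ?card_ord //.
    by rewrite divr_ge0.
  move=> w; rewrite /dp; case: (boolP (deep _ _ _)) => // /deep_card E.
  by rewrite E eqxx in Ec.
rewrite -Ec; apply: le_trans (avg_avoid0 R m (S := chain j x) _); rewrite ?Ec //.
apply: avg_le => w; rewrite ler_nat /dp; case: (boolP (deep _ _ _)) => // dx.
rewrite lt0b; apply/forall_inP => _ /imsetP[i _ ->].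
by have [] := deep_chain dx (leq_ord i).
Qed.

End Percolation.

(** * Quantities computable with few queries *)

Section Queryable.
Variables (R : realType) (T : finType).

(* A procedure in continuation-passing style: [P k] queries the oracle for the
   value [f G L] and then behaves as [k (f G L)]. *)
Definition queryable (X : Type) (c : nat)
    (f : forall G : sgraph T, adj_lists G -> X) : Prop :=
  exists P : (X -> algorithm T) -> algorithm T,
    forall (G : sgraph T) (L : adj_lists G) (k : X -> algorithm T),
      (forall b, output_prob R L (P k) b = output_prob R L (k (f G L)) b) /\
      (num_queries L (P k) <= c + num_queries L (k (f G L)))%N.

Lemma queryable_cst X (x : X) : queryable 0 (fun G (L : adj_lists G) => x).
Proof. by exists (fun k => k x). Qed.

Lemma queryable_degree v : queryable 1 (fun G (L : adj_lists G) => degree G v).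
Proof. by exists (fun k => AskDegree v k). Qed.

Lemma queryable_neighbor v i : queryable 1 (fun G (L : adj_lists G) => onth (L v) i).
Proof. by exists (fun k => AskNeighbor v i k). Qed.

Lemma queryable_leq X c c' (f : forall G : sgraph T, adj_lists G -> X) :
  (c <= c')%N -> queryable c f -> queryable c' f.
Proof.
move=> le [P PE]; exists P => G L k; have [? h] := PE G L k; split=> //.
by apply: leq_trans h _; rewrite leq_add2r.
Qed.

Lemma queryable_bind X Y c c' (f : forall G : sgraph T, adj_lists G -> X)
    (g : X -> forall G : sgraph T, adj_lists G -> Y) :
  queryable c f -> (forall x, queryable c' (g x)) ->
  queryable (c + c') (fun G L => g (f G L) G L).
Proof.
move=> [P PE] /choice[Q QE]; exists (fun k => P (fun x => Q x k)) => G L k.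
have [h1 h2] := PE G L (fun x => Q x k); have [h3 h4] := QE (f G L) G L k.
split=> [b|]; first by rewrite h1 h3.
by apply: leq_trans h2 _; rewrite -addnA leq_add2l.
Qed.

(** The queries for [f] are followed by a function, obtained by choice, that maps each value of [f]
    to the value of [g] it forces. *)
Lemma queryable_det X Y c (f : forall G : sgraph T, adj_lists G -> X)
    (g : forall G : sgraph T, adj_lists G -> Y) :
  queryable c f ->
  (forall G (L : adj_lists G) G' (L' : adj_lists G'),
     f G L = f G' L' -> g G L = g G' L') ->
  queryable c g.
Proof.
move=> [P PE] fg.
(* An instance of the oracle supplies a default in [Y] for values that [f] does not take; without
   any instance the claim is vacuous. *)
have [[G0 [L0 _]]|none] := pselect (exists (G : sgraph T) (L : adj_lists G), True); last first.
  by exists (fun _ => Output T true) => G L; case: none; exists G, L.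
have /choice[h hE] (x : X) : exists y : Y,
    forall G (L : adj_lists G), f G L = x -> g G L = y.
  have [[G [L E]]|nx] := pselect (exists (G : sgraph T) (L : adj_lists G), f G L = x).
    by exists (g G L) => G' L' E'; apply: fg; rewrite E E'.
  by exists (g G0 L0) => G L E; case: nx; exists G, L.
exists (fun k => P (fun x => k (h x))) => G L k.
by have := PE G L (fun x => k (h x)); rewrite -(hE _ G L erefl).
Qed.

Lemma queryable_ffun (I : finType) X c
    (f : I -> forall G : sgraph T, adj_lists G -> X) :
  (forall i, queryable c (f i)) ->
  queryable (#|I| * c) (fun G L => [ffun i => f i G L]).
Proof.
move=> qf.
have qs (s : seq I) : queryable (size s * c) (fun G L => [seq f i G L | i <- s]).
  elim: s => [|i s IHs] /=; first exact: queryable_cst.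
  rewrite mulSn; apply: (queryable_bind (g := fun x G L => x :: [seq f j G L | j <- s])
    (qf i)) => x.
  by apply: queryable_det IHs _ => G L G' L' ->.
rewrite cardE; apply: queryable_det (qs (enum I)) _ => G L G' L' /eq_in_map E.
by apply/ffunP => i; rewrite !ffunE E // mem_enum.
Qed.

End Queryable.

Lemma size_adj (T : finType) (G : sgraph T) (L : adj_lists G) v :
  size (L v) = degree G v.
Proof.
rewrite -(card_uniqP (adj_uniq L v)) /degree; apply: eq_card => w.
by rewrite inE mem_adj.
Qed.

(** * Local exploration of cells *)

Section Views.
Variables (R : realType) (T : finType) (D k : nat) (unc : pred T).

(** For a vertex of degree below [D] the first [D] entries are the whole neighbourhood, and the
    neighbours' degrees tell which of them are low. This determines the kept edges at [u] and its
    edges to high vertices. *)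
Definition local_view (u : T) (G : sgraph T) (L : adj_lists G) :=
  (degree G u,
   [ffun i : 'I_D => omap (fun w => (w, degree G w)) (onth (L u) i)]).

Definition view_cost : nat := 1 + D * 2.

Lemma queryable_local_view u : queryable R view_cost (local_view u).
Proof.
rewrite /view_cost.
apply: (queryable_bind (g := fun d G L =>
   (d, [ffun i : 'I_D => omap (fun w => (w, degree G w)) (onth (L u) i)]))
   (queryable_degree R u)) => d.
have qi (i : 'I_D) : queryable R 2
    (fun G (L : adj_lists G) => omap (fun w => (w, degree G w)) (onth (L u) i)).
  apply: (queryable_bind (g := fun o G L => omap (fun w => (w, degree G w)) o)
    (queryable_neighbor R u i)) => -[w|] /=.
    by apply: queryable_det (queryable_degree R w) _ => G L G' L' ->.
  by apply: (@queryable_leq _ _ _ 0) => //; apply: queryable_cst.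
have := queryable_ffun qi; rewrite card_ord.
by move=> q; apply: queryable_det q _ => G L G' L' ->.
Qed.

Lemma local_view_eq u G (L : adj_lists G) G' (L' : adj_lists G') :
  local_view u L = local_view u L' ->
  [/\ low G D u = low G' D u, low G D u -> G u =1 G' u &
      forall w, low G D u -> G u w -> degree G w = degree G' w].
Proof.
case=> dE /ffunP vE; have lE : low G D u = low G' D u by rewrite /low dE.
have some w H (K : adj_lists H) : low H D u -> H u w ->
    exists i : 'I_D, onth (K u) i = Some w.
  move=> lu Huw; have wK : w \in K u by rewrite mem_adj.
  have iK : (index w (K u) < D)%N.
    by apply: leq_trans lu; rewrite -(size_adj K) ltnS index_size.
  exists (Ordinal iK); rewrite /= onthE (nth_map w) ?index_mem //.
  by rewrite nth_index.
have sub w : low G D u -> G u w -> G' u w /\ degree G w = degree G' w.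
  move=> lu Guw; have [i iE] := some w G L lu Guw.
  have := vE i; rewrite !ffunE iE /=; case E: (onth (L' u) i) => [w'|] //= [Ew ->].
  split; rewrite Ew // -(mem_adj L').
  by move: E; rewrite onthE; have [lt|ge] := ltnP i (size (L' u));
    [rewrite (nth_map w') // => -[<-]; rewrite mem_nth | rewrite nth_default ?size_map].
have sub' w : low G' D u -> G' u w -> G u w.
  move=> lu Guw; have [i iE] := some w G' L' lu Guw.
  have := vE i; rewrite !ffunE iE /=; case E: (onth (L u) i) => [w'|] //= [Ew _].
  rewrite -Ew -(mem_adj L).
  by move: E; rewrite onthE; have [lt|ge] := ltnP i (size (L u));
    [rewrite (nth_map w') // => -[<-]; rewrite mem_nth | rewrite nth_default ?size_map].
split=> // [lu w|w lu Guw]; last by have [] := sub w lu Guw.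
by apply/idP/idP => [/sub[]//|]; apply: sub'; rewrite -lE.
Qed.

Lemma local_view_kept u G (L : adj_lists G) G' (L' : adj_lists G') :
  local_view u L = local_view u L' -> kept G D unc u =1 kept G' D unc u.
Proof.
move=> /local_view_eq[lE Gu dE] w; rewrite /kept -lE.
case: (boolP (low G D u)) => lu; rewrite ?andbF //=.
rewrite -(Gu lu); case Guw: (G u w) => //=.
by rewrite /low (dE w lu Guw).
Qed.

(** Growth is frozen above [k] vertices, so a round never has to view more than [k] of them. *)
Definition grow (G : sgraph T) (B : {set T}) : {set T} :=
  if (#|B| <= k)%N then B :|: [set w | [exists u in B, kept G D unc u w]] else B.

Definition ball (G : sgraph T) (i : nat) (v : T) : {set T} := iter i (grow G) [set v].

Lemma ball_sub G i v : ball G i v \subset cell G D unc v.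
Proof.
elim: i => [|i IHi]; first by rewrite sub1set mem_cell.
rewrite /ball iterS -/(ball G i v) {1}/grow; case: ifP => // _.
rewrite subUset IHi; apply/subsetP => w; rewrite inE => /exists_inP[u uB kuw].
by rewrite -(cell_eq (subsetP IHi u uB)) inE connect1.
Qed.

(** Each round that does not stabilise adds a vertex. After [k] rounds a ball of at most [k]
    vertices is therefore stable, hence equal to the cell. *)
Lemma ball_grow G i v : (#|ball G i v| <= k)%N -> grow G (ball G i v) = ball G i v \/
  (i < #|ball G i v|)%N.
Proof.
elim: i => [|i IHi]; first by rewrite /ball /= cards1; right.
rewrite /ball iterS -/(ball G i v) => le.
have sub : ball G i v \subset grow G (ball G i v).
  by rewrite /grow; case: ifP => // _; apply: subsetUl.
have [E|ltC] := IHi (leq_trans (subset_leq_card sub) le); first by left; rewrite !E.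
have [E|ne] := eqVneq (ball G i v) (grow G (ball G i v)).
  by left; rewrite -!E.
by right; apply: leq_ltn_trans ltC _; apply: proper_card; rewrite properEneq ne.
Qed.

Lemma ball_cell G v : (#|ball G k v| <= k)%N -> ball G k v = cell G D unc v.
Proof.
move=> le; apply/eqP; rewrite eqEsubset ball_sub /=.
have [E|lt] := ball_grow le; last by rewrite ltnNge le in lt.
apply/subsetP => w; rewrite inE => /connectP[p + ->].
have /(_ k) : forall i, v \in ball G i v.
  elim=> [|i IHi]; first by rewrite set11.
  by rewrite /ball iterS -/(ball G i v) /grow; case: ifP => // _; rewrite inE IHi.
move: (ball G k v) le E => B le E.
elim: p v => //= x p IHp v vB /andP[kvx]; apply: IHp.
rewrite -E /grow le in_setU in_set; apply/orP; right.
by apply/exists_inP; exists v.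
Qed.

Lemma ball_small G v : (#|ball G k v| <= k)%N = small G D k unc v.
Proof.
apply/idP/idP => [le|]; first by rewrite /small -ball_cell.
by apply: leq_trans; apply: subset_leq_card; apply: ball_sub.
Qed.

(** Positions past the end of the enumeration view [v] again, which makes the number of views
    independent of [B]. *)
Definition set_view (B : {set T}) (v : T) (G : sgraph T) (L : adj_lists G) :=
  [ffun i : 'I_k => local_view (nth v (enum B) i) L].

Lemma queryable_set_view B v : queryable R (k * view_cost) (set_view B v).
Proof.
rewrite -[X in (X * _)%N](card_ord k).
by apply: queryable_ffun => i; apply: queryable_local_view.
Qed.

Lemma set_view_eq B v G (L : adj_lists G) G' (L' : adj_lists G') :
  set_view B v L = set_view B v L' -> (#|B| <= k)%N ->
  {in B, forall u, local_view u L = local_view u L'}.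
Proof.
move=> /ffunP E le u uB; have iu : (index u (enum B) < k)%N.
  by apply: leq_trans le; rewrite cardE index_mem mem_enum.
by have := E (Ordinal iu); rewrite !ffunE /= nth_index // mem_enum.
Qed.

Lemma queryable_ball i v :
  queryable R (i * (k * view_cost)) (fun G (L : adj_lists G) => ball G i v).
Proof.
elim: i => [|i IHi]; first exact: queryable_cst.
rewrite mulSn addnC.
apply: (queryable_bind (g := fun B G L => grow G B) IHi) => B.
apply: queryable_det (queryable_set_view B v) _ => G L G' L' E.
rewrite /grow; case: ifP => // le; congr (_ :|: _).
apply/setP => w; rewrite !inE; apply/exists_inP/exists_inP => -[u uB kuw];
  by exists u; rewrite // ?(local_view_kept (set_view_eq E le uB)) //
     -(local_view_kept (set_view_eq E le uB)).
Qed.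

Definition rep_info (G : sgraph T) (v : T) : option (option T * piece_type k) :=
  if isrep G D k unc v then Some (anchor G D unc v, ty G D k unc v) else None.

Definition rep_cost : nat := (k * (k * view_cost) + k * view_cost)%N.

(** Exploration either exceeds [k] vertices, so that [v] is no representative, or finds the whole
    cell. For a low [v] the views of the cell's vertices then determine the edges to high vertices,
    the anchor and the type. *)
Lemma queryable_rep_info v :
  queryable R rep_cost (fun G (L : adj_lists G) => rep_info G v).
Proof.
have q := queryable_bind (g := fun B G L => (B, set_view B v L)) (queryable_ball k v).
apply: (queryable_det (q (k * view_cost)%N _)) => {q} [B|].
  by apply: queryable_det (queryable_set_view B v) _ => G L G' L' ->.
move=> G L G' L' [EB]; rewrite EB /rep_info /isrep -!ball_small EB.
case: (leqP #|ball G' k v| k) => [le|]; last by rewrite !andbF.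
move=> /set_view_eq /(_ le) E.
have cE : cell G D unc v = cell G' D unc v by rewrite -!ball_cell ?EB.
have bE := ball_cell le; rewrite bE in E.
have [lE _ _] := local_view_eq (E v (mem_cell _ _ _ _)); rewrite lE.
case: (boolP (low G' D v)) => //= lv.
have lowc u : u \in cell G' D unc v -> low G D u.
  by move=> uc; have [-> _ _] := local_view_eq (E u uc); apply: cell_low uc.
have hE : high_edges G D unc v = high_edges G' D unc v.
  apply/setP => -[u w]; rewrite [LHS]in_set [RHS]in_set /= cE; case: (boolP (u \in _)) => //= uc.
  have [_ Gu dE] := local_view_eq (E u uc).
  rewrite -(Gu (lowc u uc)); case Guw: (G u w) => //=.
  by rewrite /low (dE w (lowc u uc) Guw).
have aE : anchor G D unc v = anchor G' D unc v by rewrite /anchor hE.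
have tE : ty G D k unc v = ty G' D k unc v.
  rewrite /ty cE; congr pair; apply/ffunP => ij; rewrite !ffunE /piece cE.
  apply: local_view_kept; apply: E; set s := v :: _.
  have [lt|ge] := ltnP ij.1 (size s); last by rewrite nth_default // mem_cell.
  by rewrite -mem_piece mem_nth.
by rewrite aE hE cE tE.
Qed.

End Views.

(** * Classes of vertices *)

Section Scale.
Variables (l b : nat).

Definition scale_type := ('I_l.+1 * 'I_(2 ^ b.+1).+1)%type.

Definition scale (d : nat) : scale_type :=
  (inord (trunc_log 2 d), inord (d %/ 2 ^ (trunc_log 2 d - b))).

(* The degree rounded down to its [b.+1] leading bits. *)
Definition unscale (c : scale_type) : nat := c.2 * 2 ^ (c.1 - b).

(** Dropping the last [e - b] bits loses less than [2 ^ (e - b)], and [d] is at least [2 ^ e]. If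
    [e < b], truncated subtraction makes the rounding exact. *)
Lemma unscale_bound d : (0 < d)%N -> (trunc_log 2 d <= l)%N ->
  (unscale (scale d) <= d)%N /\ ((d - unscale (scale d)) * 2 ^ b <= d)%N.
Proof.
move=> d0 le; set e := trunc_log 2 d in le *.
have /andP[ed dlt] := trunc_log_bounds (isT : 1 < 2)%N d0; rewrite -/e in ed dlt.
have p0 : (0 < 2 ^ (e - b))%N by rewrite expn_gt0.
have q : (d %/ 2 ^ (e - b) <= 2 ^ b.+1)%N.
  apply: ltnW; rewrite ltn_divLR //; apply: leq_trans dlt _.
  by rewrite -expnD leq_exp2l //; lia.
have -> : unscale (scale d) = (d %/ 2 ^ (e - b) * 2 ^ (e - b))%N.
  by rewrite /unscale /scale /= -/e !inordK.
split; first exact: leq_trunc_div.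
have -> : (d - d %/ 2 ^ (e - b) * 2 ^ (e - b) = d %% 2 ^ (e - b))%N.
  by rewrite {1}(divn_eq d (2 ^ (e - b))) addnC addnK.
have [be|eb] := leqP b e; last first.
  by rewrite (eqP (_ : (e - b)%N == 0%N)) ?modn1 // subn_eq0 ltnW.
apply: leq_trans ed; rewrite -[X in (_ <= _ ^ X)%N](subnK be) expnD leq_mul2r.
by rewrite (ltnW (ltn_pmod _ _)) ?orbT.
Qed.

End Scale.

Section Classes.
Variables (R : realType) (T : finType) (D k l b m N : nat) (unc : pred T).
Variable x : {ffun T -> {ffun 'I_(m ^ 2) -> 'I_N}}.

Definition class_type :=
  (scale_type l b * {ffun 'I_(m ^ 2) -> option (piece_type k)})%type.

Section Instance.
Variables (G : sgraph T) (L : adj_lists G).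

Definition nbr_type (u : T) : option (piece_type k) :=
  obind (fun i => omap (fun=> i.2) i.1) (rep_info D k unc G u).

(** The class records the rounded degree and the kinds of pieces hanging at [m ^ 2] random
    neighbours; a neighbour that does not represent an anchored piece gives [None]. *)
Definition high_class (r : T) : class_type :=
  (scale l b (degree G r),
   [ffun j => obind nbr_type (onth (L r) (x r j %% degree G r))]).

(** A representative reports its own type if its piece is free, and the class of its anchor
    otherwise. High-degree vertices are thus reached through their pieces. *)
Definition vertex_class (v : T) : option (piece_type k + class_type) :=
  omap (fun i => if i.1 is Some r then inr (high_class r) else inl i.2)
       (rep_info D k unc G v).

Definition reps : {set T} := [set a | isrep G D k unc a].

End Instance.

Definition class_est (c : class_type) (t : piece_type k) : R :=
  (unscale c.1)%:R * (#|[set j | c.2 j == Some t]|%:R / (m ^ 2)%:R).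

Lemma class_est_ge0 c t : 0 <= class_est c t.
Proof. by rewrite mulr_ge0 // divr_ge0. Qed.

Definition class_cost : nat := rep_cost D k + (1 + m ^ 2 * (1 + rep_cost D k)).

Lemma queryable_vertex_class v :
  queryable R class_cost (fun G (L : adj_lists G) => vertex_class L v).
Proof.
have qr u := queryable_rep_info R D k unc u.
apply: (queryable_bind (g := fun i G L =>
  omap (fun i => if i.1 is Some r then inr (high_class L r) else inl i.2) i)
  (qr v)) => -[[[r|] t]|] /=; last 2 first.
- by apply: (@queryable_leq _ _ _ 0) => //; apply: queryable_cst.
- by apply: (@queryable_leq _ _ _ 0) => //; apply: queryable_cst.
have q d : queryable R (m ^ 2 * (1 + rep_cost D k)) (fun G (L : adj_lists G) =>
    [ffun j : 'I_(m ^ 2) => obind (nbr_type G) (onth (L r) (x r j %% d))]).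
  rewrite -[X in (X * _)%N](card_ord (m ^ 2)); apply: queryable_ffun => j.
  apply: (queryable_bind (g := fun o G L => obind (nbr_type G) o)
    (queryable_neighbor R r (x r j %% d))) => -[u|] /=.
    by apply: queryable_det (qr u) _ => G L G' L'; rewrite /nbr_type => ->.
  by apply: (@queryable_leq _ _ _ 0) => //; apply: queryable_cst.
apply: (queryable_bind (g := fun d G L => Some (inr (scale l b d,
  [ffun j : 'I_(m ^ 2) => obind (nbr_type G) (onth (L r) (x r j %% d))])))
  (queryable_degree R r)) => d.
by apply: queryable_det (q d) _ => G L G' L' ->.
Qed.

Section Counting.
Variables (G : sgraph T) (L : adj_lists G).
Local Notation A := (reps G).
Local Notation rt := (anchor G D unc).
Local Notation tp := (ty G D k unc).

Lemma key_count_class t :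
  key_count A rt tp None t =
  #|[set v | vertex_class L v == Some (inl t)]|.
Proof.
apply: eq_card => a; rewrite !inE /vertex_class /rep_info.
by case: (isrep G D k unc a) => //=; case: (rt a).
Qed.

Lemma class_weight_class c :
  class_weight A rt (high_class L) c =
  #|[set v | vertex_class L v == Some (inr c)]|.
Proof.
apply: eq_card => a; rewrite !inE /vertex_class /rep_info.
by case: (isrep G D k unc a) => //=; case: (rt a).
Qed.

Lemma anchor_high a r : a \in A -> rt a = Some r -> r \in high_set D G.
Proof. by move=> _ /anchor_edge/andP[_ h]; rewrite inE. Qed.

(** A piece anchored at [r] is represented by a neighbour of [r], and an anchored representative
    next to the high vertex [r] has [r] as its anchor. *)
Lemma key_count_nbr r t : r \in high_set D G ->
  key_count A rt tp (Some r) t =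
  #|[set i : 'I_(degree G r) | obind (nbr_type G) (onth (L r) i) == Some t]|.
Proof.
rewrite inE => hr.
have sz := size_adj L r.
pose f (i : 'I_(degree G r)) := nth r (L r) i.
have onthf i : onth (L r) i = Some (nth r (L r) i) \/ (degree G r <= i)%N.
  have [ge|lt] := leqP (degree G r) i; [by right|left].
  by rewrite onthE (nth_map r) ?sz.
have injf : injective f.
  move=> i j /eqP; rewrite /f nth_uniq ?adj_uniq ?sz ?ltn_ord // => /eqP.
  exact: val_inj.
rewrite -(card_imset _ injf); apply: eq_card => a; rewrite !inE.
apply/idP/imsetP => [/and3P[ra /eqP rta /eqP tpa]|[i iE ->]].
  have /andP[Gar _] := anchor_edge rta.
  have aL : a \in L r by rewrite mem_adj edge_sym.
  have ia : (index a (L r) < degree G r)%N by rewrite -sz index_mem.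
  exists (Ordinal ia); last by rewrite /f /= nth_index.
  rewrite inE /=; case: (onthf (index a (L r))) => [->|]; last by rewrite leqNgt ia.
  by rewrite nth_index //= /nbr_type /rep_info ra /= rta /= tpa.
move: iE; rewrite inE; case: (onthf i) => [->|]; last by rewrite leqNgt ltn_ord.
rewrite -/(f i) /= /nbr_type /rep_info; case: ifP => //= ra.
case E: (rt (f i)) => [r'|] //= /eqP[->].
have Gi : G (f i) r by rewrite edge_sym -(mem_adj L) mem_nth // sz.
have := anchor_nbr (unc := unc) _ Gi hr; rewrite E => /(_ isT) ->.
by rewrite !eqxx.
Qed.

End Counting.
End Classes.

(** Sampling neighbours costs [1 / m] for each type by [avg_frequency], and rounding the degree
    costs a fraction [2 ^ b] times smaller than the degree. *)
Lemma avg_est_error (R : realType) (T : finType) (D k l b m N : nat)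
    (unc : pred T) (G : sgraph T) (L : adj_lists G) (r : T) :
  (0 < m)%N -> (0 < N)%N -> (0 < degree G r)%N -> (degree G r %| N)%N ->
  (trunc_log 2 (degree G r) <= l)%N -> r \in high_set D G ->
  avg (fun x : {ffun T -> {ffun 'I_(m ^ 2) -> 'I_N}} =>
    est_error (@class_est R k l b m) (reps D k unc G) (anchor G D unc)
      (ty G D k unc) (high_class D k l b unc x L) r)
  <= (degree G r)%:R * (#|{: piece_type k}|%:R / m%:R + (2 ^ b)%:R^-1).
Proof.
move=> m0 N0; set d := degree G r => d0 dN dl hr.
have d0' : 0 < d%:R :> R by rewrite ltr0n.
pose smp (t : piece_type k) (y : 'I_N) := obind (nbr_type D k unc G) (onth (L r) (y %% d)) == Some t.
pose q (t : piece_type k) : R := #|[set y | smp t y]|%:R / #|'I_N|%:R.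
pose fr (t : piece_type k) (g : {ffun 'I_(m ^ 2) -> 'I_N}) : R :=
  #|[set j | smp t (g j)]|%:R / (m ^ 2)%:R.
have qE t : (key_count (reps D k unc G) (anchor G D unc) (ty G D k unc) (Some r) t)%:R
    = d%:R * q t.
  rewrite (key_count_nbr unc L) // /q card_ord mulrA.
  apply: (canRL (mulfK _)); first by rewrite pnatr_eq0 -lt0n.
  by rewrite -!natrM [in RHS]mulnC -(card_modn
    (fun i => obind (nbr_type D k unc G) (onth (L r) i) == Some t) d0 dN).
pose a := unscale (scale l b d).
have [ad da] := unscale_bound b d0 dl : (a <= d)%N /\ _.
have fr1 g : \sum_t fr t g <= 1.
  rewrite -mulr_suml ler_pdivrMr ?ltr0n ?expn_gt0 ?m0 // mul1r -natr_sum ler_nat.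
  rewrite -[leqRHS]card_ord -sum1_card.
  under eq_bigr do rewrite -sum1dep_card big_mkcond.
  rewrite exchange_big; apply: leq_sum => j _ /=; rewrite /smp.
  case: (obind _ _) => [t|]; last by rewrite big1.
  by rewrite (bigD1 t) //= eqxx big1 // => t' /negPf; rewrite eq_sym (inj_eq Some_inj) => ->.
have fr0 t g : 0 <= fr t g by rewrite divr_ge0.
apply: (@le_trans _ _ (avg (fun x : {ffun T -> {ffun 'I_(m ^ 2) -> 'I_N}} =>
    d%:R * (\sum_t `|fr t (x r) - q t|) + d%:R * (2 ^ b)%:R^-1))).
  apply: avg_le => x; rewrite /est_error.
  (* The error splits into the sampling error scaled by the true degree and the rounding error
     scaled by the sampled frequency; these frequencies sum to at most 1. *)
  have h1 t : `|(key_count (reps D k unc G) (anchor G D unc) (ty G D k unc) (Some r) t)%:R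
      - class_est R (high_class D k l b unc x L r) t|
      <= d%:R * `|fr t (x r) - q t| + (d%:R - a%:R) * fr t (x r).
    have -> : class_est R (high_class D k l b unc x L r) t
        = a%:R * fr t (x r).
      rewrite /class_est /fr; congr (_ * (_%:R / _)); apply: eq_card => j.
      by rewrite !inE ffunE.
    have -> : d%:R * `|fr t (x r) - q t| = `|d%:R * fr t (x r) - d%:R * q t|.
      by rewrite -mulrBr normrM (ger0_norm (ltW d0')).
    rewrite qE.
    have -> : d%:R * q t - a%:R * fr t (x r) =
      (d%:R * q t - d%:R * fr t (x r)) + (d%:R - a%:R) * fr t (x r) by ring.
    apply: le_trans (ler_normD _ _) _; rewrite [X in X + _ <= _]distrC lerD2l.
    by rewrite ger0_norm // mulr_ge0 // subr_ge0 ler_nat.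
  apply: le_trans (ler_sum _ (fun t _ => h1 t)) _.
  rewrite big_split /= -!mulr_sumr lerD2l.
  have da' : d%:R - a%:R <= d%:R * (2 ^ b)%:R^-1 :> R.
    rewrite -natrB // ler_pdivlMr ?ltr0n ?expn_gt0 //.
    by rewrite -natrM ler_nat.
  have : 0 <= d%:R - a%:R :> R by rewrite subr_ge0 ler_nat.
  have := fr1 (x r); move: da'; set S := \sum_t _; nra.
rewrite avgD avgZ avg_cst; last first.
  by rewrite !card_ffun !card_ord !expn_gt0 N0.
rewrite mulrDr lerD2r ler_pM2l // avg_sum.
apply: (@le_trans _ _ (\sum_(t : piece_type k) m%:R^-1)); last first.
  by rewrite sumr_const -[X in X <= _]mulr_natl.
apply: ler_sum => t _.
rewrite (avg_coord r (fun g => `|fr t g - q t|)); last first.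
  by rewrite card_ffun !card_ord expn_gt0 N0.
by apply: avg_frequency; rewrite ?card_ord.
Qed.

(** * Soundness of the comparison *)

(** Transporting anchors by [rho] puts the pieces of the two forests under common keys. *)
Lemma key_count_fiber (T PT : finType) (C : {set T}) (rt : T -> option T)
    (tp : T -> PT) (rho : {perm T}) o t :
  key_count C rt tp o t =
  #|fiber C (fun a => (omap rho (rt a), tp a)) (omap rho o, t)|.
Proof.
apply: eq_card => a; rewrite !inE ?xpair_eqE /=; congr (_ && (_ && _)).
case: (rt a) o => [r|] [r'|] //=; rewrite !(inj_eq Some_inj).
by rewrite (inj_eq perm_inj).
Qed.

Lemma key_count_fiber1 (T PT : finType) (C : {set T}) (rt : T -> option T)
    (tp : T -> PT) o t :
  key_count C rt tp o t = #|fiber C (fun a => (rt a, tp a)) (o, t)|.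
Proof. by apply: eq_card => a; rewrite !inE ?xpair_eqE. Qed.

Lemma badness_arith (R : realType) (h h' c c' g g' u u' n kk d d' t t' : R) :
  kk * u' <= kk * (n * (d + d') + 2 * t + 2 * t') ->
  kk * u <= kk * (n * (d + d') + 2 * t + 2 * t') ->
  h + (h + 0) + c + g + kk * u + (h' + (h' + 0) + c' + g' + kk * u') <=
  2 * h + c + g + 2 * kk * (n * d + 2 * t) +
  (2 * h' + c' + g' + 2 * kk * (n * d' + 2 * t')).
Proof. lra. Qed.

Section Badness.
Variables (R : realType) (T : finType) (D k l b m N M : nat).

(** The mark 0 cuts a vertex. Neighbour indices are drawn below the factorial of the number of
    vertices, which every positive degree divides. *)
Definition seed_type :=
  ({ffun T -> 'I_N.+1} * ({ffun T -> {ffun 'I_(m ^ 2) -> 'I_(#|T|`!)}}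
    * {ffun 'I_(M ^ 2) -> T}))%type.

Local Notation X := (piece_type k + class_type k l b m)%type.

Definition deviation (c : T -> option X) (v : {ffun 'I_(M ^ 2) -> T}) : R :=
  \sum_(z : X) `|#|[set i | c (v i) == Some z]|%:R / (M ^ 2)%:R
                 - #|[set u | c u == Some z]|%:R / #|T|%:R|.

Definition uncut (w : {ffun T -> 'I_N.+1}) : pred T := fun u => w u != ord0.

Definition sclass (s : seed_type) (G : sgraph T) (L : adj_lists G) :
    T -> option X :=
  vertex_class D k l b (uncut s.1) s.2.1 L.

Definition total_error (s : seed_type) (G : sgraph T) (L : adj_lists G) : R :=
  \sum_(r in high_set D G)
    est_error (@class_est R k l b m) (reps D k (uncut s.1) G)
      (anchor G D (uncut s.1)) (ty G D k (uncut s.1))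
      (high_class D k l b (uncut s.1) s.2.1 L) r.

(** This is the share of one forest in the disagreement: the terms of [lost_bound], then a bound for
    the unmatched pieces, each costing up to [k] edges. The factor 2 before [k] arises because
    unmatched pieces are counted on both sides. *)
Definition badness (s : seed_type) (G : sgraph T) (L : adj_lists G)
    (par : T -> T) : R :=
  2 * #|high_set D G|%:R + #|cut_set (uncut s.1) par|%:R
  + #|big_set D k (uncut s.1) G|%:R
  + 2 * k%:R * (#|T|%:R * deviation (sclass s L) s.2.2 + 2 * total_error s L).

Lemma sum_sum (V : nmodType) (I J : finType) (F : I + J -> V) :
  \sum_z F z = \sum_i F (inl i) + \sum_j F (inr j).
Proof. exact: big_sumType. Qed.

(** Both forests show the same empirical frequency of every class, so the true frequencies differ by
    at most the sum of the two deviations. *)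
Lemma count_deviation (s : seed_type) (G G' : sgraph T) (L : adj_lists G)
    (L' : adj_lists G') :
  (0 < #|T|)%N ->
  (forall i, sclass s L (s.2.2 i) = sclass s L' (s.2.2 i)) ->
  \sum_t `|(key_count (reps D k (uncut s.1) G) (anchor G D (uncut s.1)) (ty G D k (uncut s.1)) None t)%:R
    - (key_count (reps D k (uncut s.1) G') (anchor G' D (uncut s.1)) (ty G' D k (uncut s.1)) None t)%:R|
  + \sum_c `|(class_weight (reps D k (uncut s.1) G) (anchor G D (uncut s.1))
               (high_class D k l b (uncut s.1) s.2.1 L) c)%:R
      - (class_weight (reps D k (uncut s.1) G') (anchor G' D (uncut s.1))
               (high_class D k l b (uncut s.1) s.2.1 L') c)%:R|
  <= #|T|%:R * (deviation (sclass s L) s.2.2 + deviation (sclass s L') s.2.2) :> R.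
Proof.
move=> T0 same; set unc := uncut s.1; set x := s.2.1.
have T0' : 0 < #|T|%:R :> R by rewrite ltr0n.
under eq_bigr do rewrite !(key_count_class D l b unc x L) !(key_count_class D l b unc x L').
under [X in _ + X]eq_bigr do rewrite !class_weight_class.
rewrite -(sum_sum (fun z => `|#|[set v | vertex_class D k l b unc x L v == Some z]|%:R
  - #|[set v | vertex_class D k l b unc x L' v == Some z]|%:R|)).
rewrite /deviation -big_split /= mulr_sumr; apply: ler_sum => z _.
have -> : [set i | sclass s L' (s.2.2 i) == Some z]
        = [set i | sclass s L (s.2.2 i) == Some z].
  by apply/setP => i; rewrite !inE same.
set p : R := _ / (M ^ 2)%:R.
rewrite /sclass -/unc -/x.
set c : R := #|[set v | vertex_class D k l b unc x L v == Some z]|%:R.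
set c' : R := #|[set v | vertex_class D k l b unc x L' v == Some z]|%:R.
have -> : c - c' = #|T|%:R * ((p - c' / #|T|%:R) - (p - c / #|T|%:R)).
  by field; rewrite gt_eqF.
rewrite normrM (gtr0_norm T0') ler_pM2l //.
by rewrite [leRHS]addrC; apply: ler_normB.
Qed.

(** High-degree vertices are matched by class, then pieces by type and transported anchor. An
    aligned permutation loses few parent edges in either direction, by [unmatched_bound] applied
    both ways. *)
Lemma disagreement_badness (s : seed_type) (G G' : sgraph T) (L : adj_lists G)
    (L' : adj_lists G') par par' rk rk' :
  (0 < #|T|)%N -> rooting G par rk -> rooting G' par' rk' ->
  (forall i, sclass s L (s.2.2 i) = sclass s L' (s.2.2 i)) ->
  exists p : {perm T},
    #|disagreement G G' p|%:R <= badness s L par + badness s L' par'.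
Proof.
move=> T0 rG rG' same.
set unc := uncut s.1; set x := s.2.1.
have [rho [rho1 rho2]] := matching_exists (high_set D G) (high_set D G')
  (high_class D k l b unc x L) (high_class D k l b unc x L').
pose A := reps D k unc G; pose A' := reps D k unc G'.
pose f a := (omap rho (anchor G D unc a), ty G D k unc a).
pose g a := (anchor G' D unc a, ty G' D k unc a).
have [sg [sg1 sg2]] := matching_exists A A' f g.
have [p al] := aligned_exists D k unc G G' rho sg; exists p.
pose U := [set a | isrep G D k unc a && ~~ piece_matched D k unc G G' rho sg a].
pose U' := [set a | isrep G' D k unc a &&
                    ~~ piece_matched D k unc G' G rho^-1 sg^-1 a].
have pmE a : piece_matched D k unc G G' rho sg a = key_matched A A' f g sg a.
  by rewrite /key_matched !inE xpair_eqE.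
have UE : U = unmatched A A' f g sg.
  by apply/setP => a; rewrite [LHS]in_set [RHS]in_set pmE [a \in A]in_set.
have UE' : U' = unmatched A' A g f sg^-1.
  apply/setP => a; rewrite [LHS]in_set [RHS]in_set [a \in A']in_set.
  by rewrite -{2 4}(permKV sg a) piece_matchedV key_matchedV pmE.
have dev := count_deviation T0 same.
have devC := @count_deviation s G' G L' L T0 (fun i => esym (same i)).
have lU : #|U|%:R <= #|T|%:R * (deviation (sclass s L) s.2.2
    + deviation (sclass s L') s.2.2) + 2 * total_error s L + 2 * total_error s L'.
  apply: le_trans (unmatched_bound (@class_est_ge0 R k l b m)
    (@anchor_high T D k unc G) (@anchor_high T D k unc G') _ _ _ rho1) _.
  - by apply/subsetP => a; rewrite !inE => /andP[].
  - move=> t; rewrite (key_count_fiber U _ _ rho) UE.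
    by rewrite (key_count_fiber A _ _ rho) key_count_fiber1; apply: sg1.
  - move=> r t; rewrite (key_count_fiber U _ _ rho) UE.
    by rewrite (key_count_fiber A _ _ rho) key_count_fiber1; apply: sg1.
  apply: lerD; last exact: lexx.
  by apply: lerD; [exact: dev|exact: lexx].
have lU' : #|U'|%:R <= #|T|%:R * (deviation (sclass s L) s.2.2
    + deviation (sclass s L') s.2.2) + 2 * total_error s L + 2 * total_error s L'.
  apply: le_trans (unmatched_bound (@class_est_ge0 R k l b m)
    (@anchor_high T D k unc G') (@anchor_high T D k unc G) _ _ _ rho2) _.
  - by apply/subsetP => a; rewrite !inE => /andP[].
  - move=> t; rewrite !key_count_fiber1 UE' -(key_count_fiber1 A).
    by rewrite (key_count_fiber A _ _ rho); apply: sg2.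
  - move=> r t; rewrite !key_count_fiber1 UE' -(key_count_fiber1 A).
    by rewrite (key_count_fiber A _ _ rho) /= permKV; apply: sg2.
  rewrite [deviation (sclass s L) _ + _]addrC [leRHS]addrAC.
  apply: lerD; last exact: lexx.
  by apply: lerD; [exact: devC|exact: lexx].
have b1 := lost_bound rG al.
have b2 := lost_bound rG' (alignedV al).
have := disagreement_bound p rG rG'.
rewrite -/U in b1; rewrite -/U' in b2.
move: b1 b2; rewrite -!(ler_nat R) !natrD !natrM => b1 b2 b3.
apply: le_trans b3 _; apply: le_trans (lerD b1 b2) _.
rewrite /badness -/unc.
have k0 : 0 <= k%:R :> R by [].
have := ler_wpM2l k0 lU; have := ler_wpM2l k0 lU'.
exact: badness_arith.
Qed.

End Badness.

Lemma budget_arith (R : realType) (iD iN nj ik dj pm h t xm kk a1 a2 a3 a4 : R) :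
  a1 <= 2 * t * iN -> a2 <= t * nj + dj * t * ik -> h <= 2 * t * iD ->
  2 * kk * (t * a3 + 2 * a4) <= 2 * kk * (t * xm + 4 * t * pm) ->
  2 * h + a1 + a2 + 2 * kk * (t * a3 + 2 * a4) <=
  t * (4 * iD + 2 * iN + nj + dj * ik + 2 * kk * (xm + 4 * pm)).
Proof. lra. Qed.

(** * Average badness of a forest over the seeds *)

Section AverageBadness.
Variables (R : realType) (T : finType) (D k l b m N M : nat).
Hypotheses (T0 : (0 < #|T|)%N) (D0 : (0 < D)%N) (k0 : (0 < k)%N).
Hypotheses (m0 : (0 < m)%N) (M0 : (0 < M)%N) (Tl : (trunc_log 2 #|T| <= l)%N).
Variables (G : sgraph T) (L : adj_lists G) (par : T -> T) (rk : T -> nat).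
Hypothesis rootG : rooting G par rk.

Local Notation X := (piece_type k + class_type k l b m)%type.
Local Notation seed := (seed_type T m N M).

Lemma seed_card : (0 < #|{: seed}|)%N.
Proof.
by rewrite !card_prod !card_ffun !card_ord !muln_gt0 !expn_gt0 T0 fact_gt0.
Qed.

Lemma avg_deviation (c : T -> option X) :
  avg (fun v : {ffun 'I_(M ^ 2) -> T} => deviation R c v) <= #|{: X}|%:R / M%:R :> R.
Proof.
rewrite /deviation avg_sum; apply: (@le_trans _ _ (\sum_(z : X) M%:R^-1)).
  by apply: ler_sum => z _; apply: (avg_frequency R (fun u => c u == Some z)).
by rewrite sumr_const -[X in X <= _]mulr_natl.
Qed.

Lemma avg_le_cst (Y : finType) (f : Y -> R) (c : R) :
  (0 < #|Y|)%N -> (forall y, f y <= c) -> avg f <= c.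
Proof. by move=> Y0 fc; rewrite -(avg_cst c Y0); apply: avg_le. Qed.

(** The error at a vertex is proportional to its degree, and the degrees of a forest sum to at most
    twice the number of vertices. *)
Lemma avg_total_error (w : {ffun T -> 'I_N.+1}) (v : {ffun 'I_(M ^ 2) -> T}) :
  avg (fun x => total_error R D k l b ((w, (x, v)) : seed) L)
  <= 2 * #|T|%:R * (#|{: piece_type k}|%:R / m%:R + (2 ^ b)%:R^-1).
Proof.
rewrite /total_error avg_sum /=; set d := _ + _.
have d0 : 0 <= d by rewrite addr_ge0 ?divr_ge0 ?invr_ge0.
apply: (@le_trans _ _ (\sum_(r in high_set D G) (degree G r)%:R * d)).
  apply: ler_sum => r hr.
  have dgt : (0 < degree G r)%N.
    by move: hr; rewrite inE /low -leqNgt; apply: leq_trans.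
  have dle : (degree G r <= #|T|)%N by apply: max_card.
  apply: avg_est_error => //; first exact: fact_gt0.
    by apply: dvdn_fact; rewrite dgt.
  by apply: leq_trans Tl; apply: leq_trunc_log.
rewrite -mulr_suml ler_wpM2r // -natrM -natr_sum ler_nat.
by apply: leq_trans (sum_degree rootG); rewrite [leqRHS](bigID (mem (high_set D G))) leq_addr.
Qed.

(** The terms come, in order, from high vertices, marked edges, deep vertices, shallow vertices in
    large cells, vertex sampling, neighbour sampling and degree rounding. *)
Lemma avg_badness (j : nat) :
  avg (fun s : seed => badness R D k l b s L par) <=
  #|T|%:R * (4 / D%:R + 2 / N.+1%:R + N%:R / j.+1%:R + D.+1%:R ^+ j / k%:R
    + 2 * k%:R * (#|{: X}|%:R / M%:R
                  + 4 * (#|{: piece_type k}|%:R / m%:R + (2 ^ b)%:R^-1))).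
Proof.
have cw : (0 < #|{: {ffun T -> 'I_N.+1}}|)%N by rewrite card_ffun card_ord expn_gt0.
have cx : (0 < #|{: {ffun T -> {ffun 'I_(m ^ 2) -> 'I_(#|T|`!)}}}|)%N.
  by rewrite !card_ffun !card_ord !expn_gt0 fact_gt0.
have cv : (0 < #|{: {ffun 'I_(M ^ 2) -> T}}|)%N by rewrite card_ffun expn_gt0 T0.
have cxv : (0 < #|{: {ffun T -> {ffun 'I_(m ^ 2) -> 'I_(#|T|`!)}}
                     * {ffun 'I_(M ^ 2) -> T}}|)%N by rewrite card_prod muln_gt0 cx.
have avg1 (f : {ffun T -> 'I_N.+1} -> R) : avg (fun s : seed => f s.1) = avg f.
  by rewrite avg_pair; apply: eq_avg => w; rewrite /= avg_cst.
have t0 : 0 < #|T|%:R :> R by rewrite ltr0n.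
rewrite /badness avgD avgZ !avgD !avgZ avg_cst ?seed_card //.
rewrite (avg1 (fun w => #|cut_set (uncut w) par|%:R)).
rewrite (avg1 (fun w => #|big_set D k (uncut w) G|%:R)).
have h1 := avg_cut_set par R N.
have h2 := avg_big_set D rootG R N j k0.
have h3 : #|high_set D G|%:R <= 2 * #|T|%:R / D%:R :> R.
  rewrite ler_pdivlMr ?ltr0n // -!natrM ler_nat; exact: high_set_bound rootG.
have h4 : avg (fun s : seed => deviation R (sclass D k l b s L) s.2.2)
    <= #|{: X}|%:R / M%:R.
  rewrite avg_pair; apply: avg_le_cst => // w; rewrite avg_pair.
  apply: avg_le_cst => // x.
  exact: (avg_deviation (vertex_class D k l b (uncut w) x L)).
have h5 : avg (fun s : seed => total_error R D k l b s L)
    <= 2 * #|T|%:R * (#|{: piece_type k}|%:R / m%:R + (2 ^ b)%:R^-1).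
  rewrite avg_pair; apply: avg_le_cst => // w; rewrite avg_pair.
  have [v0 _] := card_gt0P cv.
  rewrite (@eq_avg _ _ _ (fun x => total_error R D k l b
    ((w, (x, v0)) : seed) L)); last by move=> x; rewrite /total_error /= avg_cst.
  exact: avg_total_error.
have k0' : 0 <= 2 * k%:R :> R by rewrite mulr_ge0.
move: h1 h2 h3 h4 h5; rewrite /uncut.
set a1 := avg _; set a2 := avg _; set a3 := avg _; set a4 := avg _.
move=> h1 h2 h3 h4 h5.
have h6 : 2 * k%:R * (#|T|%:R * a3 + 2 * a4) <= 2 * k%:R * (#|T|%:R *
   (#|{: X}|%:R / M%:R) + 4 * #|T|%:R * (#|{: piece_type k}|%:R / m%:R + (2 ^ b)%:R^-1)).
  apply: ler_wpM2l => //; apply: lerD; first by rewrite ler_pM2l.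
  by move: h5; set z := _ + _; lra.
move: h1 h2 h3 h6.
move: (#|high_set D G|%:R : R) (#|T|%:R : R) (#|{: X}|%:R / M%:R : R) (k%:R : R).
move: (#|{: piece_type k}|%:R / m%:R + (2 ^ b)%:R^-1 : R).
move: (D%:R^-1 : R) (N.+1%:R^-1 : R) (N%:R / j.+1%:R : R) (_ ^+ j : R).
by move=> *; apply: budget_arith.
Qed.

Lemma badness_ge0 (s : seed) : 0 <= badness R D k l b s L par.
Proof.
rewrite /badness !addr_ge0 ?mulr_ge0 ?addr_ge0 //.
  by rewrite mulr_ge0 //; apply: sumr_ge0 => z _; rewrite normr_ge0.
by rewrite mulr_ge0 //; apply: sumr_ge0 => r _; apply: est_error_ge0.
Qed.

End AverageBadness.

(** * The tester *)

Definition draw (T : Type) (S : finType) (k : S -> algorithm T) : algorithm T :=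
  if enum S is s0 :: _
  then Draw (fun i : 'I_(#|S|.-1).+1 => k (nth s0 (enum S) i))
  else Output T true.

Section Draw.
Variables (R : realType) (T S : finType) (k : S -> algorithm T).
Variables (G : sgraph T) (L : adj_lists G).

Lemma draw_prob b : (0 < #|S|)%N ->
  output_prob R L (draw k) b = avg (fun s => output_prob R L (k s) b).
Proof.
move=> S0; rewrite /draw; case E: (enum S) => [|s0 s'].
  by move: S0; rewrite cardE E.
rewrite /= -E prednK // /avg; congr (_ / _).
rewrite -[RHS]big_enum (big_nth s0) -cardE -(big_mkord xpredT
  (fun i => output_prob R L (k (nth s0 (enum S) i)) b)).
by [].
Qed.

Lemma draw_queries q : (forall s, (num_queries L (k s) <= q)%N) ->
  (num_queries L (draw k) <= q)%N.
Proof.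
move=> kq; rewrite /draw; case E: (enum S) => [|s0 s'] //=.
by apply/bigmax_leqP => i _.
Qed.

End Draw.

Lemma graph_dist_isomorphic (T : finType) (G G' H : sgraph T) (p : {perm T}) :
  isomorphic G' H -> (graph_dist G H <= #|disagreement G G' p|)%N.
Proof.
move=> [p0 p0E]; rewrite /graph_dist; case: arg_minnP => // q _ /(_ (p * p0)%g isT).
move=> le; apply: leq_trans le _; apply: subset_leq_card.
apply/subsetP => _ /imsetP[uv + ->]; rewrite inE !permM -p0E => uvE.
by apply/imsetP; exists uv; rewrite ?inE.
Qed.

Section Tester.
Variables (R : realType) (eps : R) (n D k b m N M : nat).
Local Notation T := 'I_n.
Local Notation l := (trunc_log 2 n).
Local Notation seed := (seed_type T m N M).
Hypothesis eps0 : 0 < eps.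
Hypothesis small_badness : forall (G : sgraph T) (L : adj_lists G) par rk,
  (0 < n)%N -> rooting G par rk ->
  avg (fun s : seed => badness R D k l b s L par) <= eps * n%:R / 6.

Definition good (s : seed) (G : sgraph T) (L : adj_lists G) : Prop :=
  exists par rk, rooting G par rk /\ badness R D k l b s L par < eps * n%:R / 2.

Definition transcript (s : seed) (G : sgraph T) (L : adj_lists G) :=
  [ffun i : 'I_(M ^ 2) => sclass D k l b s L (s.2.2 i)].

(** If the input is isomorphic to [H] and good, it is its own witness for acceptance. If it is good
    and far, a witness would be good for the same seed with the same transcript, hence at distance
    below [eps * n], a contradiction. *)
Lemma tester_exists : exists A : sgraph T -> algorithm T,
  forall (H G : sgraph T) (L : adj_lists G),
    (0 < n)%N -> is_forest G ->
    [/\ isomorphic G H -> 2 / 3 <= output_prob R L (A H) true,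
        eps * n%:R <= (graph_dist G H)%:R -> 2 / 3 <= output_prob R L (A H) false
      & (num_queries L (A H) <= M ^ 2 * class_cost D k m)%N].
Proof.
have qT (s : seed) : queryable R (M ^ 2 * class_cost D k m) (transcript s).
  rewrite -[X in (X * _)%N](card_ord (M ^ 2)); apply: queryable_ffun => i.
  exact: queryable_vertex_class.
have /choice[P PE] := qT.
pose accept H s t := `[< exists (G' : sgraph T) (L' : adj_lists G'),
  [/\ good s L', isomorphic G' H & transcript s L' = t] >].
exists (fun H => draw (fun s => P s (fun t => Output T (accept H s t)))).
move=> H G L n0 forG.
have T0 : (0 < #|T|)%N by rewrite card_ord.
have S0 : (0 < #|{: seed}|)%N by apply: seed_card.
have [par [rk rootG]] := forest_rooting forG.
(* Both directions need only that the input is good for the seed. The threshold is three times the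
   bound on the average, so Markov's inequality gives probability 2/3. *)
have key bb : (forall s, badness R D k l b s L par < eps * n%:R / 2 ->
      accept H s (transcript s L) = bb) ->
    2 / 3 <= output_prob R L
      (draw (fun s => P s (fun t => Output T (accept H s t)))) bb.
  move=> acc; rewrite draw_prob //.
  have en0 : 0 < eps * n%:R / 2 by rewrite divr_gt0 ?mulr_gt0 ?ltr0n.
  rewrite (@eq_avg _ _ _ (fun s => (accept H s (transcript s L) == bb)%:R)).
    apply: (avg_markov (f := fun s => badness R D k l b s L par) S0 en0).
    - by move=> s; apply: badness_ge0.
    - by apply: le_trans (small_badness L n0 rootG) _; lra.
    - by move=> s /acc ->; rewrite eqxx.
  by move=> s; have [-> _] := PE s G L (fun t => Output T (accept H s t)).
split.
- move=> isoGH; apply: key => s good_s; apply/asboolP.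
  by exists G, L; split=> //; exists par, rk.
- move=> far; apply: key => s good_s; apply/negbTE/asboolP.
  move=> [G' [L' [[par' [rk' [rootG' good_s']]] isoG'H tE]]].
  have same i : sclass D k l b s L (s.2.2 i) = sclass D k l b s L' (s.2.2 i).
    by have /ffunP/(_ i) := tE; rewrite !ffunE.
  have [p dis] := disagreement_badness R T0 rootG rootG' same.
  have := graph_dist_isomorphic G p isoG'H; rewrite -(ler_nat R) => le.
  have := le_lt_trans (le_trans far (le_trans le dis)) (ltrD good_s good_s').
  by rewrite -splitr ltxx.
- apply: draw_queries => s.
  have [_] := PE s G L (fun t => Output T (accept H s t)).
  by rewrite /= addn0.
Qed.

End Tester.

(** * Choice of parameters and query count *)

Lemma trunc_log_ln (R : realType) (n : nat) : (1 < n)%N ->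
  ((trunc_log 2 n).+1%:R : R) <= 2 / ln 2 * ln n%:R.
Proof.
move=> n1; have ln2 : 0 < ln 2 :> R by rewrite ln_gt0 // ltr1n.
have h : (trunc_log 2 n)%:R * ln 2 <= ln n%:R :> R.
  rewrite mulr_natl -lnXn // ler_ln ?posrE ?exprn_gt0 ?ltr0n ?(ltnW n1) //.
  by rewrite -natrX ler_nat trunc_logP // ltnW.
have h2 : ln 2 <= ln n%:R :> R.
  by rewrite ler_ln ?posrE ?ltr0n ?(ltnW n1) // ler_nat.
rewrite mulrAC ler_pdivlMr // -natr1; lra.
Qed.

(** Of all components of a class only the bit length of the degree depends on the number of
    vertices, so the number of classes is affine in [l]. *)
Lemma card_class (k l b m : nat) :
  #|{: piece_type k + class_type k l b m}| =
  (#|{: piece_type k}| + l.+1 * ((2 ^ b.+1).+1 *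
     #|{: {ffun 'I_(m ^ 2) -> option (piece_type k)}}|))%N.
Proof.
rewrite card_sum; congr (_ + _)%N.
rewrite card_prod mulnA; congr (_ * _)%N.
by rewrite card_prod !card_ord.
Qed.

Theorem theorem1 (R : realType) (eps : R) (eps_gt0 : 0 < eps) (eps_lt1 : eps < 1) :
  exists (A : forall n : nat, sgraph 'I_n -> algorithm 'I_n) (q : nat -> nat),
    polylog R q /\
    forall (n : nat) (H G : sgraph 'I_n) (L : adj_lists G),
      (0 < n)%N -> is_forest H -> is_forest G ->
      [/\ isomorphic G H -> 2 / 3 <= output_prob R L (A n H) true,
          eps * n%:R <= (graph_dist G H)%:R ->
            2 / 3 <= output_prob R L (A n H) false
        & (num_queries L (A n H) <= q n)%N].
Proof.
(* Seven error terms, each at most [1 / e], must add up to at most [eps / 6], whence 42. *)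
pose e := Num.bound (42 / eps).
have e_gt : 42 / eps < e%:R by apply: archi_boundP; rewrite divr_ge0 // ltW.
have e0 : 0 < e%:R :> R by apply: le_lt_trans e_gt; rewrite divr_ge0 // ltW.
have e0' : (0 < e)%N by rewrite -(ltr0n R).
have e_eps : 7 / e%:R <= eps / 6.
  by move: e_gt; rewrite ltr_pdivrMr // ler_pdivrMr //; lra.
(* Each parameter brings one term of [avg_badness] down to [1 / e], in terms of those fixed before
   it. Only [M], proportional to the number [W n] of classes, depends on [n]. *)
pose D := (4 * e)%N; pose N := (2 * e)%N; pose j := (N * e)%N.
have [k kE] : exists k, k = (D.+1 ^ j * e)%N by eexists.
have k0 : (0 < k)%N by rewrite kE muln_gt0 expn_gt0.
pose K := #|{: piece_type k}|.
pose m := (8 * k * K * e)%N; pose b := (8 * k * e)%N.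
pose Q := ((2 ^ b.+1).+1 * #|{: {ffun 'I_(m ^ 2) -> option (piece_type k)}}|)%N.
pose W n := (K + (trunc_log 2 n).+1 * Q)%N.
pose M n := (2 * k * W n * e)%N.
have D0 : (0 < D)%N by rewrite muln_gt0.
have K0 : (0 < K)%N by apply/card_gt0P; exists (ord0, [ffun=> true]).
have m0 : (0 < m)%N by rewrite muln_gt0 e0' andbT muln_gt0 K0 andbT muln_gt0 k0.
have W0 n : (0 < W n)%N by rewrite addn_gt0 K0.
have M0 n : (0 < M n)%N.
  by rewrite muln_gt0 e0' andbT muln_gt0 W0 andbT muln_gt0 k0.
have tester n := @tester_exists R eps n D k b m N (M n) eps_gt0.
have {}tester n : exists A : sgraph 'I_n -> algorithm 'I_n,
    forall (H G : sgraph 'I_n) (L : adj_lists G), (0 < n)%N -> is_forest G ->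
    [/\ isomorphic G H -> 2 / 3 <= output_prob R L (A H) true,
        eps * n%:R <= (graph_dist G H)%:R -> 2 / 3 <= output_prob R L (A H) false
      & (num_queries L (A H) <= M n ^ 2 * class_cost D k m)%N].
  apply: tester => G L par rk n0 rootG.
  have cT : (0 < #|'I_n|)%N by rewrite card_ord.
  have lT : (trunc_log 2 #|'I_n| <= trunc_log 2 n)%N by rewrite card_ord.
  have := avg_badness R b N cT D0 k0 m0 (M0 n) lT L rootG j.
  move/le_trans; apply.
  rewrite card_ord [leRHS]mulrAC [leRHS]mulrC ler_pM2l ?ltr0n //.
  apply: le_trans e_eps; rewrite card_class -/K -/Q -/(W n).
  have p0 (i : nat) : (0 < i)%N -> i%:R != 0 :> R by rewrite pnatr_eq0 -lt0n.
  have nW : (W n)%:R != 0 :> R by apply: p0.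
  have [ne nk nK] : [/\ e%:R != 0 :> R, k%:R != 0 :> R & K%:R != 0 :> R].
    by split; apply: p0.
  have t1 : 4 / D%:R = e%:R^-1 :> R by rewrite natrM; field.
  have t2 : 2 / N.+1%:R <= e%:R^-1 :> R.
    rewrite ler_pdivrMr ?ltr0n // ler_pdivlMl //.
    by rewrite mulrC -natrM ler_nat /N mulnC.
  have t3 : N%:R / j.+1%:R <= e%:R^-1 :> R.
    by rewrite ler_pdivrMr ?ltr0n // ler_pdivlMl // -natrM ler_nat mulnC.
  have t4 : D.+1%:R ^+ j / k%:R = e%:R^-1 :> R.
    rewrite kE natrM natrX invfM mulrA mulfV ?mul1r //.
    by rewrite expf_neq0 // p0.
  have t5 : 2 * k%:R * ((W n)%:R / (M n)%:R) = e%:R^-1 :> R.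
    by rewrite /M !natrM; field; rewrite ?ne ?nk ?nW ?nK.
  have t6 : 2 * k%:R * (4 * (K%:R / m%:R)) = e%:R^-1 :> R.
    by rewrite /m !natrM; field; rewrite ?ne ?nk ?nW ?nK.
  have t7 : 2 * k%:R * (4 * (2 ^ b)%:R^-1) <= e%:R^-1 :> R.
    rewrite !mulrA ler_pdivrMr ?ltr0n ?expn_gt0 // ler_pdivlMl //.
    apply: (@le_trans _ _ b%:R); last by rewrite ler_nat ltnW // ltn_expl.
    by rewrite /b !natrM; lra.
  rewrite !mulrDr t1 t4 t5 t6.
  move: t2 t3 t7; move: (2 / _) (N%:R / _) (2 * _ * (4 * (2 ^ b)%:R^-1)) (e%:R^-1).
  by move=> *; lra.
exists (fun n => sval (cid (tester n))).
exists (fun n => (M n ^ 2 * class_cost D k m)%N); split; last first.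
  by move=> n H G L n0 _ forG; apply: (svalP (cid (tester n))).
(* The exponent is 2 because [M n] is linear in the logarithm, [M n ^ 2] vertices are sampled, and
   each costs a number of queries independent of [n]. *)
exists ((2 * k * (K + Q) * e)%:R ^+ 2 * (class_cost D k m)%:R * (2 / ln 2) ^+ 2), 2.
move=> n n1; have tl := trunc_log_ln R n1.
have ln2 : 0 < ln 2 :> R by rewrite ln_gt0 // ltr1n.
have le : (M n)%:R <= (2 * k * (K + Q) * e)%:R * (2 / ln 2 * ln n%:R) :> R.
  apply: (@le_trans _ _ ((2 * k * (K + Q) * e)%:R * (trunc_log 2 n).+1%:R)).
    rewrite -natrM ler_nat /M [leqRHS]mulnAC leq_mul2r; apply/orP; right.
    rewrite -[leqRHS]mulnA leq_mul2l; apply/orP; right.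
    by rewrite mulnDl leq_add // ?leq_pmulr // mulnC.
  by rewrite ler_wpM2l.
rewrite natrM natrX [leRHS](_ : _ = ((2 * k * (K + Q) * e)%:R
  * (2 / ln 2 * ln n%:R)) ^+ 2 * (class_cost D k m)%:R); last by rewrite !exprMn; ring.
by rewrite ler_wpM2r // lerXn2r ?nnegrE // (le_trans _ le).
Qed.
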